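(* Let $d=n-1$, let $K:\mathbb{T}^{d-1}\times\mathbb{T}^\ell\to U$ be smooth (not assumed to be exactly invariant), write $\bar\theta=\theta+\omega$, $\bar\varphi=\varphi+\alpha$, and define $$E^K(\theta,\varphi):=\phi_T\big(K(\theta,\varphi),\varphi\big)-K(\bar\theta,\bar\varphi),\qquad \mathcal{X}_H(\theta,\varphi):=X_H\big(K(\theta,\varphi),\varphi\big)-\mathrm{D}_\varphi K(\theta,\varphi)\hat\alpha,$$ $$\eta^{31}(\theta,\varphi):=-\mathrm{D}_\theta K(\bar\theta,\bar\varphi)^\top\Omega\big(K(\bar\theta,\bar\varphi)\big)E^K(\theta,\varphi),\qquad \eta^{32}(\theta,\varphi):=-\mathcal{X}_H(\bar\theta,\bar\varphi)^\top\Omega\big(K(\bar\theta,\bar\varphi)\big)E^K(\theta,\varphi).$$ Then the averages of $\eta^{31}$ and $\eta^{32}$ are $$\langle\eta^{31}\rangle=-\big\langle \mathrm{D}_\theta E^K(\theta,\varphi)^\top\Delta^1a(\theta,\varphi)+\mathrm{D}_\theta K(\bar\theta,\bar\varphi)^\top\Delta^2a(\theta,\varphi)\big\rangle,$$ $$\langle\eta^{32}\rangle=\big\langle\Delta^1a(\theta,\varphi)^\top\mathrm{D}_\varphi E^K(\theta,\varphi)\hat\alpha\big\rangle+\big\langle\Delta^2a(\theta,\varphi)^\top\mathrm{D}_\varphi K(\bar\theta,\bar\varphi)\hat\alpha\big\rangle-\big\langle\Delta^2H(\theta,\varphi)\big\rangle,$$ where the Taylor remainders $\Delta^i$ of order $i$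 in $E^K$ are $$\Delta^1a(\theta,\varphi):=a\big(\phi_T(K(\theta,\varphi),\varphi)\big)-a\big(K(\bar\theta,\bar\varphi)\big)=\int_0^1\mathrm{D}a\big(K(\bar\theta,\bar\varphi)+sE^K(\theta,\varphi)\big)E^K(\theta,\varphi)\,ds,$$ $$\begin{aligned}\Delta^2a(\theta,\varphi)&:=a\big(\phi_T(K(\theta,\varphi),\varphi)\big)-a\big(K(\bar\theta,\bar\varphi)\big)-\mathrm{D}a\big(K(\bar\theta,\bar\varphi)\big)E^K(\theta,\varphi)\\&=\int_0^1(1-s)\,\mathrm{D}^2a\big(K(\bar\theta,\bar\varphi)+sE^K(\theta,\varphi)\big)[E^K(\theta,\varphi),E^K(\theta,\varphi)]\,ds,\end{aligned}$$ $$\begin{aligned}\Delta^2H(\theta,\varphi)&:=H\big(\phi_T(K(\theta,\varphi),\varphi),\bar\varphi\big)-H\big(K(\bar\theta,\bar\varphi),\bar\varphi\big)-\mathrm{D}_zH\big(K(\bar\theta,\bar\varphi),\bar\varphi\big)E^K(\theta,\varphi)\\&=\int_0^1(1-s)\,\mathrm{D}_z^2H\big(K(\bar\theta,\bar\varphi)+sE^K(\theta,\varphi),\bar\varphi\big)[E^K(\theta,\varphi),E^K(\theta,\varphi)]\,ds.\end{aligned}$$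
   Context: All maps are assumed sufficiently smooth. $\mathbb{T}^m=\mathbb{R}^m/\mathbb{Z}^m$; $U\subset\mathbb{R}^{2n}$ is open. $\mathrm{D}$, $\mathrm{D}_z$, $\mathrm{D}_\theta$, $\mathrm{D}_\varphi$ denote (partial) Jacobian matrices, so the derivative of a scalar function is a row vector; $\mathrm{D}^2$, $\mathrm{D}_z^2$ denote second differentials viewed as bilinear maps. The notation $\mathrm{D}_\theta K(\bar\theta,\bar\varphi)$ means the Jacobian of $K$ evaluated at $(\bar\theta,\bar\varphi)$, and similarly for $\mathrm{D}_\varphi K(\bar\theta,\bar\varphi)$. $a:U\to\mathbb{R}^{2n}$ is a smooth map such that $\Omega(z):=\mathrm{D}a(z)^\top-\mathrm{D}a(z)$ is invertible for every $z\in U$ ($\Omega$ represents an exact symplectic form on $U$). $\hat\alpha\in\mathbb{R}^\ell$ is fixed, $H:U\times\mathbb{T}^\ell\to\mathbb{R}$ is a smooth Hamiltonian and $X_H(z,\varphi):=\Omega(z)^{-1}\mathrm{D}_zH(z,\varphi)^\top$. The evolution operator $\phi_t(z,\varphi)\in U$ is the solution of $\frac{d}{dt}\phi_t(z,\varphi)=X_H\big(\phi_t(z,\varphi),\varphi+\hat\alpha t\big)$, $\phi_0(z,\varphi)=z$, on its maximal interval of existence. $T>0$ is fixed, $\omega\in\mathbb{R}^{d-1}$, $\alpha:=T\hat\alpha\in\mathbb{R}^\ell$; $\phi_T$ is assumed to be defined at all points $(K(\theta,\varphi),\varphi)$, and the segments $\{K(\bar\theta,\bar\varphi)+sE^K(\theta,\varphi):s\in[0,1]\}$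 are assumed to lie in $U$ (needed only for the integral expressions of the remainders). $\langle\zeta\rangle:=\int_{\mathbb{T}^{d-1}}\int_{\mathbb{T}^\ell}\zeta(\theta,\varphi)\,d\varphi\,d\theta$ denotes the average of a function on $\mathbb{T}^{d-1}\times\mathbb{T}^\ell$ (componentwise for vector-valued functions). *)

(* Defs.v *)
From HB Require Import structures.
From mathcomp Require Import all_boot all_order all_algebra.
From mathcomp Require Import all_classical all_reals all_analysis.

Set Implicit Arguments.
Unset Strict Implicit.
Unset Printing Implicit Defensive.

Import Order.TTheory GRing.Theory Num.Theory.
Import numFieldNormedType.Exports.

Local Open Scope classical_set_scope.
Local Open Scope ring_scope.

Section Calculus.
Context {R : realType}.

(* For W finite-dimensional, C^k.+1 of f amounts to C^k of every directional
   derivative; differentiability is in the Fréchet sense. *)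
Fixpoint Ck (k : nat) (V W : normedModType R) (U : set V) (f : V -> W) : Prop :=
  match k with
  | 0%N => forall x, U x -> {for x, continuous f}
  | k'.+1 => (forall x, U x -> differentiable f x) /\
             (forall v : V, Ck k' U (fun x => 'D_v f x))
  end.

Definition jac (m k : nat) (f : 'cV[R]_m -> 'cV[R]_k) (x : 'cV[R]_m) :
    'M[R]_(k, m) :=
  \matrix_(i, j) ('D_(delta_mx j 0) f x) i 0.

Definition jac_scalar (m : nat) (f : 'cV[R]_m -> R) (x : 'cV[R]_m) : 'rV[R]_m :=
  \row_j 'D_(delta_mx j 0) f x.

(* D^2 f(x)[v, w] *)
Definition second_diff (V W : normedModType R) (f : V -> W) (x v w : V) : W :=
  'D_v (fun y => 'D_w f y) x.

(* Functions on the torus R^m / Z^m are represented by their Z^m-periodic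
   lifts to R^m. *)
Definition Zperiodic (m : nat) (S : Type) (f : 'cV[R]_m -> S) : Prop :=
  forall (x : 'cV[R]_m) (k : 'cV[int]_m), f (x + map_mx intr k) = f x.

(* Integral over [0,1]^m, a fundamental domain of R^m / Z^m, as an iterated
   Lebesgue integral. *)
Fixpoint torus_integral (m : nat) : ('cV[R]_m -> R) -> R :=
  match m with
  | 0%N => fun f => f 0
  | m'.+1 => fun f =>
      \int[lebesgue_measure]_(t in `[0, 1])
        torus_integral (fun x : 'cV[R]_m' => f (col_mx (t%:M : 'cV[R]_1) x))
  end.

Definition average (m l : nat) (f : 'cV[R]_m -> 'cV[R]_l -> R) : R :=
  torus_integral (fun theta => torus_integral (fun phi => f theta phi)).

Definition average_vec (m l k : nat)
    (f : 'cV[R]_m -> 'cV[R]_l -> 'cV[R]_k) : 'cV[R]_k :=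
  \col_i average (fun theta phi => f theta phi i 0).

Definition integral01_vec (k : nat) (f : R -> 'cV[R]_k) : 'cV[R]_k :=
  \col_i \int[lebesgue_measure]_(s in `[0, 1]) f s i 0.

End Calculus.

Section Hamiltonian.
Context {R : realType} {N l : nat}.
Variables (U : set 'cV[R]_N) (a : 'cV[R]_N -> 'cV[R]_N).
Variables (H : 'cV[R]_N -> 'cV[R]_l -> R) (hatalpha : 'cV[R]_l).

Definition Omega (z : 'cV[R]_N) : 'M[R]_N := (jac a z)^T - jac a z.

Definition XH (z : 'cV[R]_N) (phi : 'cV[R]_l) : 'cV[R]_N :=
  invmx (Omega z) *m (jac_scalar (H ^~ phi) z)^T.

Definition solution_on (J : set R) (z : 'cV[R]_N) (phi : 'cV[R]_l)
    (x : R -> 'cV[R]_N) : Prop :=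
  [/\ is_interval J, open J, J 0, x 0 = z &
      forall t, J t ->
        U (x t) /\ is_derive t 1 x (XH (x t) (phi + t *: hatalpha))].

Definition maximal_interval (z : 'cV[R]_N) (phi : 'cV[R]_l) : set R :=
  [set t | exists J x, solution_on J z phi x /\ J t].

(* The maximal interval is the union of all the open intervals around 0 carrying
   a solution in U; flow is unconstrained outside of it. *)
Definition evolution_operator
    (flow : R -> 'cV[R]_N -> 'cV[R]_l -> 'cV[R]_N) : Prop :=
  forall z phi, U z ->
    solution_on (maximal_interval z phi) z phi (fun t => flow t z phi).

End Hamiltonian.

(* Main.v *)
Require Import Defs.
From HB Require Import structures.
From mathcomp Require Import all_boot all_order all_algebra.
From mathcomp Require Import all_classical all_reals all_analysis.
From mathcomp Require Import ring lra.

Set Implicit Arguments.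
Unset Strict Implicit.
Unset Printing Implicit Defensive.

Import Order.TTheory GRing.Theory Num.Theory.
Import numFieldNormedType.Exports.

Local Open Scope classical_set_scope.
Local Open Scope ring_scope.

(**
Everything rests on the first variation of the action. Along the trajectory x(t)
issued from K(theta, phi) consider

  p(theta, phi) = int_0^T (a(x) . X_H(x, phi + t alpha') - H(x, phi + t alpha')) dt

with alpha' the frequency vector hatalpha. The equation of motion
Omega X_H = D_z H^T is the Euler-Lagrange equation of this integrand, so that the
first variation of p only has boundary terms: with F = phi_T(K(theta, phi), phi),
for every constant direction v = (u, c alpha') in the (theta, phi) variables,

  a(F) . D_v F - D_v p - c H(F, phibar) = a(K) . D_v K - c H(K, phi)        (1)

(lemma action_identity). Write Kbar for K at the shifted angles, E = F - Kbar,
w = a(Kbar) . E, and psi for the right-hand side of (1). Expanding Omega as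
Da^T - Da, identity (1) turns into the pointwise identity

  - D_v Kbar . Omega(Kbar) E + D_v E . Delta1a + D_v Kbar . Delta2a
      - c (H(F, phibar) - H(Kbar, phibar)) = D_v p - D_v w - (psi o shift - psi).

All functions on the right are periodic, so derivatives and shift differences average
to zero (lemma average_balance). The choice v = (e_i, 0), c = 0 gives the i-th entry of
the average of eta31. The choice v = (0, alpha'), c = 1 gives that of eta32, because
X_H^T Omega = - D_z H turns the X_H part of eta32 into D_z H E, that is
H(F, phibar) - H(Kbar, phibar) - Delta2H.

Two analytic facts carry this computation.

First, F and p are continuously differentiable along every direction. The state
(x, phase, action) solves one autonomous equation y' = G(y) with G of class C^1. The
difference quotients r = (y(q' + h v) - y(q')) / h of its solutions satisfy
r' = A(t) r + o(1), with A the linearization of G along the trajectory of q, and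
Gronwall's inequality makes them Cauchy as (q', h) -> (q, 0) (quotient_cauchy).
Because the base point q' moves together with h, the limit is a derivative that is
continuous in q and additive in v (strict_derivative_continuous, strict_derivativeD);
the variational equation never has to be solved. Identity (1) is then the limit of a
conservation law that holds up to o(1) for the quotients (action_defect).
Periodicity of F and p is uniqueness of solutions.

Second, the iterated integral of a periodic function does not see translations, so the
integral of g(q + h v) is constant in h, and differentiating under the integral sign
shows that D_v g has average zero (average_derive).

The integral forms of the remainders are Taylor's formula on the segment from Kbar
to F (taylor_order1, taylor_order2).
*)

(** * Gronwall inequality in normed modules *)

Lemma is_derive_dist (R : realType) (V : normedModType R) (u : R -> V) (t : R)
    (du : V) (e : R) : is_derive t 1 u du -> 0 < e ->
  \forall h \near 0, `|u (t + h) - u t - h *: du| <= e * `|h|.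
Proof.
move=> [udr <-] e0; have := derivable_nbhs udr.
move=> /eqaddoP/(_ _ e0); apply: filterS => h /=.
by rewrite !fctE /= /cst scaler1 [h + t]addrC opprD addrA.
Qed.

Lemma is_derive_continuous (R : realType) (V : normedModType R) (u : R -> V)
    (t : R) (du : V) : is_derive t 1 u du -> {for t, continuous u}.
Proof.
by case=> /derivable1_diffP udr _; exact: differentiable_continuous.
Qed.

(** Comparison with c * expR ((C + 2) * t): at the first time when the norm of u reaches
this bound, the norm would have to grow at least at rate (C + 2) times the bound,
whereas its growth rate is at most (C + 1) times the bound. The hypothesis on du is only
asked for while the bound holds, so the lemma also confines u to the region where an
estimate on du is available. *)
Lemma gronwall (R : realType) (V : normedModType R) (u du : R -> V)
    (T c C : R) : 0 <= C -> `|u 0| < c ->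
  (forall t : R, 0 <= t <= T -> is_derive t 1 u (du t)) ->
  (forall t : R, 0 <= t <= T -> `|u t| <= c * expR ((C + 2) * t) ->
     `|du t| <= C * `|u t| + c) ->
  forall t, 0 <= t <= T -> `|u t| < c * expR ((C + 2) * t).
Proof.
move=> C0 u0c udu dub.
pose B t := c * expR ((C + 2) * t).
have c0 : 0 < c by apply: le_lt_trans u0c.
have B0 t : 0 < B t by rewrite mulr_gt0// expR_gt0.
(* B dominates the additive constant c, which absorbs the inhomogeneous term. *)
have cB t : 0 <= t -> c <= B t.
  by move=> t0; rewrite ler_peMr ?(ltW c0)// -[X in X <= _]expR0 ler_expR mulr_ge0 // addr_ge0.
have dB (t : R) : is_derive t (1 : R) B ((C + 2) * B t).
  rewrite /B; apply: is_derive_eq; rewrite /GRing.scale/=; ring.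
move=> t1 t1T; rewrite ltNge; apply/negP => Bt1.
pose S := [set t | 0 <= t <= T /\ B t <= `|u t|].
have hS : has_inf S.
  by split; [exists t1 | exists 0 => t [/andP[]]].
pose s := inf S.
have s0 : 0 <= s by apply: lb_le_inf => [|t [/andP[]]//]; exists t1.
have sT : s <= T.
  by apply: (@le_trans _ _ t1); [apply: ge_inf => //; apply hS.2|case/andP: t1T].
have sin : 0 <= s <= T by rewrite s0.
have below t : 0 <= t -> t < s -> `|u t| < B t.
  move=> t0 ts; rewrite ltNge; apply/negP => Bt.
  have : s <= t by apply: ge_inf; [apply hS.2|split=> //; rewrite t0 (ltW (lt_le_trans ts sT))].
  by rewrite leNgt ts.
have cu : {for s, continuous u} := is_derive_continuous (udu _ sin).
have cB' : {for s, continuous B} := is_derive_continuous (dB s).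
have cn : {for s, continuous (fun t => `|u t|)} by apply: cvg_norm.
have Bs : B s <= `|u s|.
  rewrite leNgt; apply/negP => lt.
  have : \forall t \near s, `|u t| < B t.
    have : \forall t \near s, 0 < (B \- (fun t => `|u t|)) t.
      by apply: (cvgr_gt _ (cvgB cB' cn)); rewrite subr_gt0.
    by apply: filterS => t /=; rewrite subr_gt0.
  move=> /nbhs_ballP[r /= r0 hr].
  have [t [St Bt] ts] := inf_adherent r0 hS.
  have st : s <= t by apply: ge_inf => //; apply hS.2.
  have /hr : ball s r t.
    by rewrite -ball_normE/= ler0_norm ?subr_le0//; move: ts; rewrite -/s; lra.
  by rewrite ltNge Bt.
have s_gt0 : 0 < s.
  rewrite lt_neqAle s0 andbT; apply/eqP => s00.
  by move: Bs; rewrite -s00 /B mulr0 expR0 mulr1 leNgt u0c.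
have us : `|u s| = B s.
  apply/eqP; rewrite eq_le Bs andbT leNgt; apply/negP => lt.
  have : \forall t \near s, B t < `|u t|.
    have : \forall t \near s, (B \- (fun t => `|u t|)) t < 0.
      by apply: (cvgr_lt _ (cvgB cB' cn)); rewrite subr_lt0.
    by apply: filterS => t /=; rewrite subr_lt0.
  move=> /nbhs_ballP[r /= r0 hr].
  have m0 : 0 < Num.min (r / 2) s by rewrite lt_min s_gt0 divr_gt0.
  have mr : Num.min (r / 2) s <= r / 2 by rewrite ge_min lexx.
  have ms : Num.min (r / 2) s <= s by rewrite ge_min lexx orbT.
  set m := Num.min _ _ in m0 mr ms.
  have /hr : ball s r (s - m).
    by rewrite -ball_normE/= opprB addrC subrK gtr0_norm//; lra.
  have : `|u (s - m)| < B (s - m) by apply: below; lra.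
  by move=> /lt_trans h /h; rewrite ltxx.
have dus := dub _ sin; rewrite us in dus.
have {}dus := dus (lexx _).
have cs := cB _ s0.
(* At s the norm equals B, and just before s it is smaller: the tolerance B s / 4 on both
   difference quotients is below the gap between the two growth rates. *)
have e0 : 0 < B s / 4 by rewrite divr_gt0 ?B0.
have := is_derive_dist (udu _ sin) e0.
have := is_derive_dist (dB s) e0.
move=> n1 n2.
have /nbhs_ballP[r /= r0 hr] : \forall h \near (0 : R),
    `|B (s + h) - B s - h *: ((C + 2) * B s)| <= B s / 4 * `|h| /\
    `|u (s + h) - u s - h *: du s| <= B s / 4 * `|h|.
  by apply: filterS2 n1 n2 => h.
have m0 : 0 < Num.min (r / 2) s by rewrite lt_min s_gt0 divr_gt0.
have mr : Num.min (r / 2) s <= r / 2 by rewrite ge_min lexx.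
have ms : Num.min (r / 2) s <= s by rewrite ge_min lexx orbT.
set m := Num.min _ _ in m0 mr ms.
have [|] := hr (- m).
  by rewrite -ball_normE/= sub0r opprK gtr0_norm//; lra.
rewrite normrN (gtr0_norm m0) => b1 b2.
have lt : `|u (s - m)| < B (s - m) by apply: below; lra.
have tri : `|u s| <= `|u (s - m)| + `|u (s - m) - u s - (- m) *: du s| + m * `|du s|.
  rewrite -[in X in _ <= _ + _ + X](gtr0_norm m0) -[`|m|]normrN -normrZ.
  rewrite [X in `|X| <= _](_ : _ = u (s - m) - (u (s - m) - u s - (- m) *: du s) - (- m) *: du
      s); last first.
    by rewrite opprB addrA addrAC addrK subKr.
  apply: (le_trans (ler_normB _ _)); rewrite lerD2r.
  exact: ler_normB.
move: b1; rewrite ler_norml => /andP[_].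
rewrite /GRing.scale /= => b1.
move: tri b1 b2 dus lt; rewrite us; set b := B s; set b' := B (s - m) => tri b1 b2 dus lt.
have : m * `|du s| <= m * ((C + 1) * b).
  by rewrite ler_pM2l//; apply: (le_trans dus); rewrite mulrDl mul1r lerD2l.
have : 0 < m * b by rewrite mulr_gt0// B0.
move: tri b1 b2 lt.
nra.
Qed.

(** * Dependence of solutions of differential equations on parameters *)

Lemma linear_scale (R : pzRingType) (V W : lmodType R) (f : V -> W) :
  linear f -> forall a u, f (a *: u) = a *: f u.
Proof.
move=> lf a u; have f0 : f 0 = 0.
  by move: (lf (-1) 0 0); rewrite scaler0 addr0 scaleN1r addNr.
by move: (lf a u 0); rewrite !addr0 f0 addr0.
Qed.

Lemma linear_sub (R : pzRingType) (V W : lmodType R) (f : V -> W) :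
  linear f -> {morph f : u v / u - v}.
Proof.
move=> lf u v; have := lf (-1) v u.
rewrite !scaleN1r [- v + _]addrC [- f v + _]addrC => -> //.
Qed.

(** The base point x' of the linear map A x' moves along with z1 and z2. One estimate thus
expresses both strict differentiability and continuity of the derivative in operator
norm, and it passes to components and compositions without any coordinates. *)
Definition strictly_C1 (R : realType) (V W : normedModType R) (D : set V)
    (f : V -> W) (A : V -> V -> W) : Prop :=
  [/\ forall x, D x -> linear (A x),
      forall x, D x -> exists C d : R, 0 < d /\
        forall x', `|x' - x| < d -> forall v, `|A x' v| <= C * `|v| &
      forall x, D x -> forall e : R, 0 < e -> exists d : R, 0 < d /\
        forall x' z1 z2, `|x' - x| < d -> `|z1 - x| < d -> `|z2 - x| < d ->
          `|f z1 - f z2 - A x' (z1 - z2)| <= e * `|z1 - z2|].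

Definition is_solution (R : realType) (V : normedModType R) (G : V -> V)
    (T : R) (y : R -> V) : Prop :=
  forall t : R, 0 <= t <= T -> is_derive t 1 y (G (y t)).

Section perturbation.
Context (R : realType) (V : normedModType R) (D : set V) (G : V -> V).
Context (A : V -> V -> V) (hG : strictly_C1 D G A) (T : R) (y0 : R -> V).
Context (y0D : forall t : R, 0 <= t <= T -> D (y0 t)).
Context (sol0 : is_solution G T y0).

(** Uniformity in t is compactness of the time interval [0, T]. *)
Lemma tube_linearization (e : R) : 0 < e -> exists d : R, 0 < d /\
  forall t : R, 0 <= t <= T -> forall z1 z2,
    `|z1 - y0 t| < d -> `|z2 - y0 t| < d ->
    `|G z1 - G z2 - A (y0 t) (z1 - z2)| <= e * `|z1 - z2|.
Proof.
move=> e0; have [_ _ strict] := hG.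
have /compact_near_coveringP cov : compact `[0, T] by exact: segment_compact.
pose P (d t : R) := forall z1 z2,
    `|z1 - y0 t| < d -> `|z2 - y0 t| < d ->
    `|G z1 - G z2 - A (y0 t) (z1 - z2)| <= e * `|z1 - z2|.
have : \forall d \near 0^'+, `[0, T]%classic `<=` P d.
  apply: cov => t0; rewrite /= in_itv/= => t0T.
  have [d [d0 hd]] := strict _ (y0D t0T) _ e0.
  have d20 : 0 < d / 2 by rewrite divr_gt0.
  have near_t : \forall t \near t0, `|y0 t - y0 t0| < d / 2.
    exact: (cvgr_distC_lt _ _ (is_derive_continuous (sol0 t0T)) _ d20).
  near=> t d'.
  have td : `|y0 t - y0 t0| < d / 2 by near: t; exact: near_t.
  have d'd : d' < d / 2 by near: d'; exact: nbhs_right_lt.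
  have aux z : `|z - y0 t| < d' -> `|z - y0 t0| < d.
    move=> zt; rewrite -(subrKA (y0 t)); apply: le_lt_trans (ler_normD _ _) _; lra.
  by move=> z1 z2 /aux z1d /aux z2d; apply: hd => //; lra.
move=> n; have [d [d0 hd]] : exists d, 0 < d /\ `[0, T]%classic `<=` P d.
  near (0 : R)^'+ => d; exists d; split; last by near: d.
  by near: d; exact: nbhs_right_gt.
by exists d; split => // t tT; apply: hd; rewrite /= in_itv.
Unshelve. all: by end_near. Qed.

Lemma tube_bound : exists C : R, 0 <= C /\
  forall t : R, 0 <= t <= T -> forall v, `|A (y0 t) v| <= C * `|v|.
Proof.
have [_ bnd _] := hG.
have /compact_near_coveringP cov : compact `[0, T] by exact: segment_compact.
pose P (C t : R) := forall v, `|A (y0 t) v| <= C * `|v|.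
have n : \forall C \near +oo, `[0, T]%classic `<=` P C.
  apply: cov => t0; rewrite /= in_itv/= => t0T.
  have [C [d [d0 hd]]] := bnd _ (y0D t0T).
  have near_t : \forall t \near t0, `|y0 t - y0 t0| < d.
    exact: (cvgr_distC_lt _ _ (is_derive_continuous (sol0 t0T)) _ d0).
  near=> t C'.
  have td : `|y0 t - y0 t0| < d by near: t; exact: near_t.
  have CC' : C <= C' by near: C'; apply: nbhs_pinfty_ge; exact: num_real.
  by move=> v; apply: (le_trans (hd _ td v)); exact: ler_wpM2r.
near (+oo : set_system R) => C; exists C; split.
  by near: C; apply: nbhs_pinfty_ge; exact: num_real.
move=> t tT; have : `[0, T]%classic `<=` P C by near: C.
by apply; rewrite /= in_itv.
Unshelve. all: by end_near. Qed.

(** Lipschitz dependence on initial values. The trap in Gronwall's inequality keeps every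
solution that starts close enough to y0 inside the tube where G is Lipschitz, so no
global bound on G is needed. *)
Lemma solutions_remain_close : 0 <= T -> exists L d : R, [/\ 0 < L, 0 < d,
  forall y c, is_solution G T y -> `|y 0 - y0 0| < c -> c * L < d ->
    forall t : R, 0 <= t <= T -> `|y t - y0 t| < c * L &
  forall y1 y2 c c1, is_solution G T y1 -> is_solution G T y2 ->
    `|y1 0 - y0 0| < c1 -> `|y2 0 - y0 0| < c1 -> c1 * L < d ->
    `|y2 0 - y1 0| < c ->
    forall t : R, 0 <= t <= T -> `|y2 t - y1 t| < c * L].
Proof.
move=> T0; have [C [C0 hC]] := tube_bound.
have [d [d0 hd]] := tube_linearization ltr01.
exists (expR ((C + 1 + 2) * T)), d.
have C10 : 0 <= C + 1 by rewrite addr_ge0.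
have lip t z1 z2 : 0 <= t <= T -> `|z1 - y0 t| < d -> `|z2 - y0 t| < d ->
    `|G z1 - G z2| <= (C + 1) * `|z1 - z2|.
  move=> tT z1d z2d; rewrite -(subrK (A (y0 t) (z1 - z2)) (G z1 - G z2)).
  apply: (le_trans (ler_normD _ _)); rewrite mulrDl addrC lerD//.
    exact: hC.
  exact: hd.
have mono c t : 0 <= c -> 0 <= t <= T ->
    c * expR ((C + 1 + 2) * t) <= c * expR ((C + 1 + 2) * T).
  move=> c0 /andP[_ tT]; rewrite ler_wpM2l// ler_expR ler_wpM2l//; lra.
have close y c : is_solution G T y -> `|y 0 - y0 0| < c ->
    c * expR ((C + 1 + 2) * T) < d ->
    forall t : R, 0 <= t <= T -> `|y t - y0 t| < c * expR ((C + 1 + 2) * T).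
  move=> sol y00 cd t tT.
  have c0 : 0 < c by apply: le_lt_trans y00.
  apply: lt_le_trans (mono _ _ (ltW c0) tT).
  apply: (@gronwall R V (y - y0) (fun t => G (y t) - G (y0 t)) T) => //.
  - by move=> s sT; apply: is_deriveB; [exact: sol|exact: sol0].
  - move=> s sT sB; apply: (le_trans (lip s _ _ sT _ _)).
    + by apply: le_lt_trans sB _; apply: le_lt_trans cd; exact: mono (ltW c0) sT.
    + by rewrite subrr normr0.
    + by rewrite lerDl ltW.
split => //; first exact: expR_gt0.
move=> y1 y2 c c1 sol1 sol2 y10 y20 c1d y12 t tT.
have c0 : 0 < c by apply: le_lt_trans y12.
apply: lt_le_trans (mono _ _ (ltW c0) tT).
apply: (@gronwall R V (y2 - y1) (fun t => G (y2 t) - G (y1 t)) T) => //.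
- by move=> s sT; apply: is_deriveB; [exact: sol2|exact: sol1].
- move=> s sT sB; apply: (le_trans (lip s _ _ sT _ _)).
  + exact: (lt_trans (close _ _ sol2 y20 c1d _ sT) c1d).
  + exact: (lt_trans (close _ _ sol1 y10 c1d _ sT) c1d).
  + by rewrite lerDl ltW.
Qed.

Lemma solution_unique y : 0 <= T -> is_solution G T y -> y 0 = y0 0 ->
  forall t : R, 0 <= t <= T -> y t = y0 t.
Proof.
move=> T0 sol y00 t tT; have [L [d [L0 d0 close _]]] := solutions_remain_close T0.
(* Both solutions start at the same point, so every positive initial distance is admissible. *)
apply/eqP; rewrite -subr_eq0 -normr_le0; apply/ler_addgt0Pr => e e0; rewrite add0r.
have m0 : 0 < Num.min (e / L) (d / L / 2) by rewrite lt_min !divr_gt0.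
have me : Num.min (e / L) (d / L / 2) <= e / L by rewrite ge_min lexx.
have md : Num.min (e / L) (d / L / 2) <= d / L / 2 by rewrite ge_min lexx orbT.
apply/ltW; apply: (@lt_le_trans _ _ (Num.min (e / L) (d / L / 2) * L)).
  apply: close => //; first by rewrite y00 subrr normr0.
  rewrite -ltr_pdivlMr//; apply: (le_lt_trans md).
  by rewrite ltr_pdivrMr// ltr_pMr ?ltr1n// divr_gt0.
by rewrite -ler_pdivlMr.
Qed.

Context (I : Type) (F : set_system I) (FF : Filter F).
Context (y1 y2 : I -> R -> V) (h : I -> R) (rho : V).
Context (sol1 : forall i, is_solution G T (y1 i)).
Context (sol2 : forall i, is_solution G T (y2 i)).
Context (h0 : \forall i \near F, h i != 0).
Context (cvg1 : y1 i 0 @[i --> F] --> y0 0).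
Context (cvg2 : y2 i 0 @[i --> F] --> y0 0).
Context (cvg_quot : (h i)^-1 *: (y2 i 0 - y1 i 0) @[i --> F] --> rho).
Context (T0 : 0 <= T).

Let r i t := (h i)^-1 *: (y2 i t - y1 i t).
Let dr i t := (h i)^-1 *: (G (y2 i t) - G (y1 i t)).

Lemma is_derive_quotient i t : 0 <= t <= T -> is_derive t 1 (r i) (dr i t).
Proof.
move=> tT; apply: is_deriveZ; apply: is_deriveB; [exact: sol2|exact: sol1].
Qed.

(** The difference quotients of two nearby solutions are bounded by Lipschitz dependence,
and strict differentiability of G along y0 makes the quotient of the field values equal
to the linearization applied to the quotient, up to an error uniform in time. *)
Lemma quotient_linearized : exists M : R, 0 < M /\ forall e : R, 0 < e ->
  \forall i \near F, forall t : R, 0 <= t <= T ->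
    `|r i t| <= M /\ `|dr i t - A (y0 t) (r i t)| <= e.
Proof.
have [L [d [L0 d0 close close2]]] := solutions_remain_close T0.
have r10 : 0 < `|rho| + 1 by rewrite ltr_pwDr.
pose M := (`|rho| + 1) * L.
have M0 : 0 < M by rewrite mulr_gt0.
exists M; split => // e e0.
have e'0 : 0 < e / M by rewrite divr_gt0.
have [d' [d'0 hd']] := tube_linearization e'0.
pose m := Num.min (d / L / 2) (d' / L).
have m0 : 0 < m by rewrite lt_min !divr_gt0.
have mLd : m * L < d.
  rewrite -ltr_pdivlMr//; apply: (@le_lt_trans _ _ (d / L / 2)).
    by rewrite ge_min lexx.
  by rewrite ltr_pdivrMr// ltr_pMr ?ltr1n// divr_gt0.
have mLd' : m * L <= d' by rewrite -ler_pdivlMr// ge_min lexx orbT.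
have n1 : \forall i \near F, `|y1 i 0 - y0 0| < m by exact: (cvgr_distC_lt _ _ cvg1).
have n2 : \forall i \near F, `|y2 i 0 - y0 0| < m by exact: (cvgr_distC_lt _ _ cvg2).
have n3 : \forall i \near F, `|r i 0| < `|rho| + 1.
  by apply: (cvgr_norm_lt _ cvg_quot); rewrite ltrDl.
near=> i => t tT.
have hi : h i != 0 by near: i.
have hi0 : 0 < `|h i| by rewrite normr_gt0.
have y1m : `|y1 i 0 - y0 0| < m by near: i.
have y2m : `|y2 i 0 - y0 0| < m by near: i.
have r0 : `|r i 0| < `|rho| + 1 by near: i.
have y12 : `|y2 i 0 - y1 i 0| < `|h i| * (`|rho| + 1).
  by move: r0; rewrite /r normrZ normfV mulrC ltr_pdivrMr// mulrC.
have rM : `|r i t| <= M.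
  rewrite /r normrZ normfV mulrC ler_pdivrMr// /M [leRHS]mulrC mulrA.
  exact/ltW/(close2 (y1 i) (y2 i) _ m).
split=> //.
have [lin _ _] := hG.
have -> : A (y0 t) (r i t) = (h i)^-1 *: A (y0 t) (y2 i t - y1 i t).
  exact: linear_scale (lin _ (y0D tT)) _ _.
rewrite /dr -scalerBr normrZ normfV.
apply: (@le_trans _ _ (`|h i|^-1 * (e / M * `|y2 i t - y1 i t|))).
  rewrite ler_wpM2l ?invr_ge0//; apply: hd' => //.
    exact: (lt_le_trans (close _ _ (sol2 i) y2m mLd _ tT) mLd').
  exact: (lt_le_trans (close _ _ (sol1 i) y1m mLd _ tT) mLd').
rewrite mulrCA -normfV -normrZ -/(r i t) -[leRHS](divfK (lt0r_neq0 M0)).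
by rewrite ler_wpM2l// ltW.
Unshelve. all: by end_near. Qed.

(** Two quotients satisfy the same linear equation up to a small error, so their
difference is controlled by Gronwall's inequality. The limit is obtained without an
existence theorem for the variational equation. *)
Lemma quotient_cauchy (e : R) : 0 < e -> exists N : set I, F N /\
  forall i j, N i -> N j -> `|r i T - r j T| <= e.
Proof.
move=> e0; have [C [C0 hC]] := tube_bound.
have [M [M0 hM]] := quotient_linearized.
pose c := e / expR ((C + 2) * T).
have c0 : 0 < c by rewrite divr_gt0 ?expR_gt0.
have c20 : 0 < c / 2 by rewrite divr_gt0.
have nl := hM _ c20.
have nr : \forall i \near F, `|r i 0 - rho| < c / 2 := cvgr_distC_lt _ _ cvg_quot _ c20.
have n : \forall i \near F, `|r i 0 - rho| < c / 2 /\ forall t : R, 0 <= t <= T ->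
    `|r i t| <= M /\ `|dr i t - A (y0 t) (r i t)| <= c / 2.
  near=> i; split; near: i; [exact: nr|exact: nl].
exists [set i | `|r i 0 - rho| < c / 2 /\ forall t : R, 0 <= t <= T ->
    `|r i t| <= M /\ `|dr i t - A (y0 t) (r i t)| <= c / 2]; split => //.
move=> i j [ri0 hi] [rj0 hj].
have TT : 0 <= T <= T by rewrite T0 lexx.
suff : `|(r i - r j) T| < c * expR ((C + 2) * T).
  by rewrite /c divfK ?gt_eqF ?expR_gt0// => /ltW.
apply: (@gronwall R V (r i - r j) (fun t => dr i t - dr j t) T) => //.
- rewrite (_ : (r i - r j) 0 = (r i 0 - rho) - (r j 0 - rho)).
    apply: le_lt_trans (ler_normB _ _) _; lra.
  by rewrite !fctE opprB addrA subrK.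
- by move=> t tT; apply: is_deriveB; exact: is_derive_quotient.
- move=> t tT _; have [lin _ _] := hG.
  have -> : dr i t - dr j t = A (y0 t) ((r i - r j) t) +
     ((dr i t - A (y0 t) (r i t)) - (dr j t - A (y0 t) (r j t))).
    by rewrite !fctE (linear_sub (lin _ (y0D tT))) opprB
      [dr i t - _ + _]addrC addrA subrKA [RHS]addrC subrKA.
  apply: (le_trans (ler_normD _ _)); apply: lerD; first exact: hC.
  apply: (le_trans (ler_normB _ _)).
  have := (hi _ tT).2; have := (hj _ tT).2; lra.
Unshelve. all: by end_near. Qed.

End perturbation.

(** * Integrals over the unit interval *)

Lemma continuous_pair2 (S T U W : topologicalType) (f : T -> U -> W)
    (a : S -> T) (b : S -> U) :
  continuous (fun p : T * U => f p.1 p.2) -> continuous a -> continuous b ->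
  continuous (fun z => f (a z) (b z)).
Proof.
move=> cf ca cb z.
apply: (@continuous_comp _ _ _ (fun z => (a z, b z)) (fun p => f p.1 p.2)).
  by apply: cvg_pair; [exact: ca|exact: cb].
exact: cf.
Qed.

Lemma cvg_mx (R : realType) (I : Type) (F : set_system I) (FF : Filter F)
    (m n : nat) (f : I -> 'M[R]_(m, n)) (l : 'M[R]_(m, n)) :
  (forall i j, f x i j @[x --> F] --> l i j) -> f x @[x --> F] --> l.
Proof.
move=> fl; apply/cvgrPdist_le => /= e e0; near=> x.
rewrite /Num.Def.normr/= mx_normrE (bigmax_le _ (ltW e0))//= => i _.
rewrite !mxE/=.
move: i; near: x; apply: filter_forall => /= i.
exact: ((cvgrPdist_le _ _).1 (fl i.1 i.2)).
Unshelve. all: by end_near. Qed.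

Section integral01.
Context (R : realType).
Notation mu := (@lebesgue_measure R).

Lemma integrable01 (f : R -> R) : (forall t, 0 <= t <= 1 -> {for t, continuous f}) ->
  mu.-integrable `[0, 1] (EFin \o f).
Proof.
move=> cf; apply: continuous_compact_integrable; first exact: segment_compact.
apply: continuous_in_subspaceT => t; rewrite inE/= in_itv/=; exact: cf.
Qed.

Lemma FTC_Rintegral (f F : R -> R) (a b : R) : a < b ->
  (forall t, a <= t <= b -> {for t, continuous f}) ->
  (forall t, a <= t <= b -> is_derive t 1 F (f t)) ->
  \int[mu]_(t in `[a, b]) f t = F b - F a.
Proof.
move=> ab cf dF.
have cF t : a <= t <= b -> {for t, continuous F}.
  by move=> tab; exact: is_derive_continuous (dF _ tab).
rewrite /Rintegral (@continuous_FTC2 _ f F)//.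
- by apply: continuous_in_subspaceT => t; rewrite inE/= in_itv/=; exact: cf.
- split.
  + move=> t; rewrite in_itv/= => /andP[at_ tb].
    by have [] := dF t; rewrite ?(ltW at_) ?(ltW tb).
  + apply: cvg_at_right_filter; apply: cF; rewrite lexx ltW//.
  + apply: cvg_at_left_filter; apply: cF; rewrite lexx ltW//.
- move=> t; rewrite in_itv/= => /andP[at_ tb]; rewrite derive1E.
  by apply: derive_val; apply: dF; rewrite !ltW.
Qed.

(** Compactness of [0, 1] turns continuity at each point of the segment into closeness that
is uniform over the segment. *)
Lemma near_segment (P : topologicalType) (f : P -> R -> R) (p0 : P) (e : R) :
  continuous (fun p : P * R => f p.1 p.2) -> 0 < e ->
  \forall p \near p0, forall t, 0 <= t <= 1 -> `|f p t - f p0 t| < e.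
Proof.
move=> cf e0.
have /compact_near_coveringP cov : compact `[0 : R, 1] by exact: segment_compact.
suff H : \forall p \near p0, `[0 : R, 1]%classic `<=` (fun t => `|f p t - f p0 t| < e).
  by apply: filterS H => p hp t t01; apply: hp; rewrite /= in_itv.
apply: cov => t0 _.
have c1 : {for (t0, p0), continuous (fun z : R * P => f z.2 z.1 - f p0 z.1)}.
  apply: cvgB; last first.
    exact: (@continuous_pair2 _ _ _ _ f (fun=> p0) fst cf (fun=> cvg_cst _) (fun z => cvg_fst)).
  exact: (@continuous_pair2 _ _ _ _ f snd fst cf (fun z => cvg_snd) (fun z => cvg_fst)).
have := cvgr_norm_lt _ c1 e; rewrite /= subrr normr0 => /(_ _ e0).
by [].
Qed.

Lemma Rintegral01_dist (f g : R -> R) (e : R) : continuous f -> continuous g ->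
  (forall t, 0 <= t <= 1 -> `|f t - g t| <= e) ->
  `|\int[mu]_(t in `[0, 1]) f t - \int[mu]_(t in `[0, 1]) g t| <= e.
Proof.
move=> cf cg fg.
have If : mu.-integrable `[0, 1] (EFin \o f) by apply: integrable01 => t _; exact: cf.
have Ig : mu.-integrable `[0, 1] (EFin \o g) by apply: integrable01 => t _; exact: cg.
have Ifg : mu.-integrable `[0, 1] (EFin \o (f \- g)).
  by apply: integrable01 => t _; apply: cvgB; [exact: cf|exact: cg].
rewrite -RintegralB//.
apply: le_trans (le_normr_Rintegral _ Ifg) _ => //.
have <- : \int[mu]_(t in `[0, 1]) (cst e) t = e.
  by rewrite Rintegral_cst//= lebesgue_measure_itv/= lte_fin ltr01 oppr0 adde0 mulr1.
apply: le_Rintegral => //.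
- apply: integrable01 => t _; apply: cvg_norm; apply: cvgB; [exact: cf|exact: cg].
- by apply: integrable01 => t _; exact: cvg_cst.
Qed.

Lemma continuous_Rintegral01 (P : topologicalType) (f : P -> R -> R) :
  continuous (fun p : P * R => f p.1 p.2) ->
  continuous (fun p => \int[mu]_(t in `[0, 1]) f p t).
Proof.
move=> cf p0; apply/cvgrPdist_le => /= e e0.
have cfp p : continuous (f p).
  exact: (@continuous_pair2 _ _ _ _ f (fun=> p) id cf (fun=> cvg_cst _) (fun z => cvg_id)).
near=> p; apply: Rintegral01_dist => // t t01; rewrite distrC ltW//.
move: t t01; near: p; exact: near_segment.
Unshelve. all: by end_near. Qed.

(** The derivative df is bounded on a strip around h by compactness, which provides the
constant that dominates it. *)
Lemma is_derive_Rintegral01 (f df : R -> R -> R) (h : R) :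
  (forall h, continuous (f h)) ->
  continuous (fun p : R * R => df p.1 p.2) ->
  (forall x t : R, is_derive x (1 : R) (f ^~ t) (df x t)) ->
  is_derive h 1 (fun h => \int[mu]_(t in `[0, 1]) f h t)
    (\int[mu]_(t in `[0, 1]) df h t).
Proof.
move=> cf cdf fdf.
have cdfh : continuous (df h).
  exact: (@continuous_pair2 _ _ _ _ df (fun=> h) id cdf (fun=> cvg_cst _) (fun z => cvg_id)).
have [M [M0 hM]] : exists M, 0 <= M /\ forall t, 0 <= t <= 1 -> `|df h t| <= M.
  have cn : {within `[0, 1], continuous (fun t => `|df h t|)}.
    by apply: continuous_subspaceT => t; apply: cvg_norm; exact: cdfh.
  have [c c01 hc] := EVT_max (@ler01 R) cn; exists `|df h c|; split => // t t01.
have [r /= r0 hr] : exists2 r, 0 < r & forall x t, `|x - h| < r -> 0 <= t <= 1 ->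
    `|df x t| <= M + 1.
  have /nbhs_ballP[r /= r0 hr] := near_segment h cdf ltr01.
  exists r => // x t xr t01; have := hr x; rewrite -ball_normE/= distrC => /(_ xr t t01).
  move=> H; rewrite -(subrK (df h t) (df x t)); apply: (le_trans (ler_normD _ _)).
  by rewrite addrC lerD ?hM// ltW.
have Ih : `]h - r, h + r[%classic h by rewrite /= in_itv/=; lra.
have d1 x t : partial1of2 f x t = df x t.
  by rewrite partial1of2E; apply: derive_val.
have dom x t : `]h - r, h + r[%classic x -> `[0 : R, 1]%classic t ->
    `|partial1of2 f x t| <= cst (M + 1) t.
  rewrite /= !in_itv/= => /andP[x1 x2] t01; rewrite d1; apply: hr => //.
  by rewrite ltr_norml; lra.
have intf x : `]h - r, h + r[%classic x -> mu.-integrable `[0, 1] (EFin \o f x).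
  by move=> _; apply: integrable01 => t _; exact: cf.
have intG : mu.-integrable `[0, 1] (EFin \o cst (M + 1)).
  by apply: integrable01 => t _; exact: cvg_cst.
have df1 x t : `]h - r, h + r[%classic x -> `[0 : R, 1]%classic t -> derivable (f ^~ t) x 1.
  by move=> _ _; case: (fdf x t).
split.
  by apply: (derivable_under_integral _ Ih intf df1 _ intG dom) => // t; rewrite /= addr_ge0.
rewrite -derive1E (differentiation_under_integral _ Ih intf df1 _ intG dom) //.
  by apply: eq_Rintegral => t _; rewrite d1.
by move=> t; rewrite /= addr_ge0.
Qed.

(** With P a primitive of k, the left-hand side is P (1 + c) - P c, whose derivative in c
vanishes by periodicity. *)
Lemma Rintegral01_shift (k : R -> R) (c : R) : continuous k ->
  (forall t, k (t + 1) = k t) ->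
  \int[mu]_(t in `[0, 1]) k (t + c) = \int[mu]_(t in `[0, 1]) k t.
Proof.
(* A negative shift is undone by a positive one. *)
wlog c0 : k c / 0 <= c => [hw ck perk|ck perk].
  have [c0|c0] := leP 0 c; first exact: hw.
  have ckc : continuous (fun t => k (t + c)).
    move=> t; apply: (@continuous_comp _ _ _ (fun t => t + c) k); last exact: ck.
    by apply: cvgD; [exact: cvg_id|exact: cvg_cst].
  rewrite -(hw (fun t => k (t + c)) (- c)) ?oppr_ge0 ?(ltW c0)//; last first.
    by move=> t; rewrite addrAC perk.
  by apply: eq_Rintegral => t _; rewrite subrK.
pose P x := \int[mu]_(t in `[-1, x]) k t.
have dP (x : R) : -1 < x -> is_derive x 1 P (k x).
  move=> x1; have int : mu.-integrable `[-1, x + 1] (EFin \o k).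
    apply: continuous_compact_integrable; first exact: segment_compact.
    exact: continuous_subspaceT.
  have [|dP Pk] := continuous_FTC1_closed _ int x1 (ck x); first by rewrite ltrDl.
  by split; [exact: dP|rewrite -derive1E; exact: Pk].
have dshift (a x : R) : -1 < x + a -> is_derive x 1 (fun x => P (x + a)) (k (x + a)).
  move=> xa; have dPa := dP _ xa.
  have da : is_derive x (1 : R) (fun x : R => x + a) 1.
    by apply: is_derive_eq; rewrite addr0.
  have := @is_derive1_comp R P (fun x => x + a) x _ _ dPa da.
  by rewrite mulr1.
clearbody P.
have ckc a : continuous (fun t => k (t + a)).
  move=> t; apply: (@continuous_comp _ _ _ (fun t => t + a) k); last exact: ck.
  by apply: cvgD; [exact: cvg_id|exact: cvg_cst].
have -> : \int[mu]_(t in `[0, 1]) k (t + c) = P (1 + c) - P (0 + c).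
  apply: (@FTC_Rintegral (fun t => k (t + c)) (fun t => P (t + c))).
  - exact: ltr01.
  - by move=> t _; exact: ckc.
  - by move=> t /andP[t0 t1]; apply: dshift; lra.
have -> : \int[mu]_(t in `[0, 1]) k t = P 1 - P 0.
  apply: (@FTC_Rintegral k P).
  - exact: ltr01.
  - by move=> t _; exact: ck.
  - by move=> t /andP[t0 t1]; apply: dP; lra.
pose psi x := P (x + 1) - P x.
have dpsi (x : R) : -1 < x -> is_derive x 1 psi 0.
  move=> x1; rewrite -(subrr (k x)) -[X in X - _]perk.
  by apply: is_deriveB; [apply: dshift; lra|exact: dP].
have [| |y _] := @MVT_segment R psi (fun=> 0) 0 c c0.
- by move=> x; rewrite in_itv/= => /andP[x0 _]; apply: dpsi; lra.
- apply: continuous_in_subspaceT => x; rewrite inE/= in_itv/= => /andP[x0 _].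
  by apply: is_derive_continuous (dpsi x _); lra.
rewrite mul0r /psi !add0r => /eqP; rewrite subr_eq0 => /eqP.
by rewrite [1 + c]addrC.
Qed.

End integral01.

(** * Integrals over the torus *)

Section torus.
Context (R : realType).
Notation mu := (@lebesgue_measure R).

Lemma continuous_col_mx (S : topologicalType) (m : nat) (a : S -> R)
    (b : S -> 'cV[R]_m) : continuous a -> continuous b ->
  continuous (fun z => col_mx ((a z)%:M : 'cV[R]_1) (b z)).
Proof.
move=> ca cb z; apply: cvg_mx => i j; rewrite mxE.
case: splitP => k ik.
  rewrite mxE !ord1 eqxx mulr1n.
  have := ca z; apply: cvg_trans; apply: near_eq_cvg; near=> x.
  by rewrite mxE; case: splitP => k' ik'; [rewrite mxE !ord1 eqxx|have := ltn_ord k; rewrite -ik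
      ik' ltnNge leq_addr].
have : (fun x => b x k j) @ z --> b z k j.
  apply: (@continuous_comp _ _ _ b (fun M : 'cV[R]_m => M k j)); first exact: cb.
  exact: coord_continuous.
apply: cvg_trans; apply: near_eq_cvg; near=> x.
rewrite mxE; case: splitP => k' ik'.
  by have := ltn_ord k'; rewrite -ik' ik ltnNge leq_addr.
by congr (b x _ _); apply: val_inj; apply/eqP; rewrite -(eqn_add2l 1) -ik' -ik.
Unshelve. all: by end_near. Qed.

Lemma continuous_torus_integral (m : nat) (P : topologicalType)
    (f : P -> 'cV[R]_m -> R) :
  continuous (fun p : P * 'cV[R]_m => f p.1 p.2) ->
  continuous (fun p => torus_integral (f p)).
Proof.
elim: m P f => [|m IH] P f cf.
  exact: (@continuous_pair2 _ _ _ _ f id (fun=> 0) cf (fun z => cvg_id) (fun=> cvg_cst _)).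
apply: (@continuous_Rintegral01 R P
  (fun p t => torus_integral (fun x : 'cV[R]_m => f p (col_mx (t%:M : 'cV[R]_1) x)))).
apply: (IH _ (fun (p : P * R) x => f p.1 (col_mx (p.2%:M : 'cV[R]_1) x))).
apply: (@continuous_pair2 _ _ 'cV[R]_m.+1 _ f (fun z => z.1.1)
  (fun z => col_mx (z.1.2%:M : 'cV[R]_1) z.2) cf).
  move=> z; apply: (@continuous_comp _ _ _ fst fst); exact: cvg_fst.
apply: (@continuous_col_mx _ m).
  by move=> z; apply: (@continuous_comp _ _ _ fst snd); [exact: cvg_fst|exact: cvg_snd].
by move=> z; exact: cvg_snd.
Qed.

Lemma continuous_slice (m : nat) (f : 'cV[R]_m.+1 -> R) : continuous f ->
  continuous (fun p : R * 'cV[R]_m => f (col_mx (p.1%:M : 'cV[R]_1) p.2)).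
Proof.
move=> cf z.
apply: (@continuous_comp _ 'cV[R]_m.+1 _ (fun p : R * 'cV[R]_m => col_mx (p.1%:M : 'cV[R]_1) p.2)
    f); last exact: cf.
by apply: (@continuous_col_mx _ m); move=> x; [exact: cvg_fst|exact: cvg_snd].
Qed.

Lemma continuous_section (P Q S : topologicalType) (f : P -> Q -> S) (p : P) :
  continuous (fun z : P * Q => f z.1 z.2) -> continuous (f p).
Proof.
move=> cf.
exact: (@continuous_pair2 _ _ _ _ f (fun=> p) id cf (fun=> cvg_cst _) (fun z => cvg_id)).
Qed.

Lemma continuous_slice_at (m : nat) (f : 'cV[R]_m.+1 -> R) (t : R) : continuous f ->
  continuous (fun x : 'cV[R]_m => f (col_mx (t%:M : 'cV[R]_1) x)).
Proof.
move=> cf; exact: (@continuous_section _ _ _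
  (fun (t : R) (x : 'cV[R]_m) => f (col_mx (t%:M : 'cV[R]_1) x)) t (continuous_slice cf)).
Qed.

Lemma torus_integralB (m : nat) (f g : 'cV[R]_m -> R) :
  continuous f -> continuous g ->
  torus_integral (fun x => f x - g x) = torus_integral f - torus_integral g.
Proof.
elim: m f g => [//|m IH] f g cf cg /=.
have If (h : 'cV[R]_m.+1 -> R) : continuous h -> mu.-integrable `[0, 1] (EFin \o (fun t =>
    torus_integral (fun x : 'cV[R]_m => h (col_mx (t%:M : 'cV[R]_1) x)))).
  move=> ch; apply: integrable01 => t _.
  by apply: (@continuous_torus_integral _ _ (fun t x => h (col_mx (t%:M : 'cV[R]_1) x))); exact:
      continuous_slice.
rewrite -RintegralB//; [|exact: If|exact: If].
apply: eq_Rintegral => t _; apply: IH.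
- exact: continuous_slice_at.
- exact: continuous_slice_at.
Qed.

Lemma is_derive_torus_integral (m : nat) (f df : R -> 'cV[R]_m -> R) (h : R) :
  continuous (fun p : R * 'cV[R]_m => f p.1 p.2) ->
  continuous (fun p : R * 'cV[R]_m => df p.1 p.2) ->
  (forall (t : R) x, is_derive t (1 : R) (f ^~ x) (df t x)) ->
  is_derive h (1 : R) (fun h => torus_integral (f h)) (torus_integral (df h)).
Proof.
elim: m f df h => [f df h _ _ fdf|m IH f df h cf cdf fdf]; first exact: fdf.
have slice (g : R -> 'cV[R]_m.+1 -> R) : continuous (fun p : R * 'cV[R]_m.+1 => g p.1 p.2) ->
    continuous (fun p : (R * R) * 'cV[R]_m => g p.1.1 (col_mx (p.1.2%:M : 'cV[R]_1) p.2)).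
  move=> cg; apply: (@continuous_pair2 _ _ 'cV[R]_m.+1 _ g (fun z => z.1.1)
    (fun z => col_mx (z.1.2%:M : 'cV[R]_1) z.2) cg).
    move=> z; apply: (@continuous_comp _ _ _ fst fst); exact: cvg_fst.
  apply: (@continuous_col_mx _ m).
    by move=> z; apply: (@continuous_comp _ _ _ fst snd); [exact: cvg_fst|exact: cvg_snd].
  by move=> z; exact: cvg_snd.
have slice2 (g : R -> 'cV[R]_m.+1 -> R) (t : R) : continuous (fun p : R * 'cV[R]_m.+1 => g p.1
    p.2) ->
    continuous (fun p : R * 'cV[R]_m => g p.1 (col_mx (t%:M : 'cV[R]_1) p.2)).
  move=> cg; apply: (@continuous_pair2 _ _ 'cV[R]_m.+1 _ g (fun z => z.1)
    (fun z => col_mx (t%:M : 'cV[R]_1) z.2) cg); first by move=> z; exact: cvg_fst.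
  by apply: (@continuous_col_mx _ m); [move=> z; exact: cvg_cst|move=> z; exact: cvg_snd].
apply: (@is_derive_Rintegral01 R
  (fun h t => torus_integral (fun x : 'cV[R]_m => f h (col_mx (t%:M : 'cV[R]_1) x)))
  (fun h t => torus_integral (fun x : 'cV[R]_m => df h (col_mx (t%:M : 'cV[R]_1) x)))).
- move=> s; apply: (@continuous_section _ _ _ (fun s t => torus_integral (fun x : 'cV[R]_m => f s
    (col_mx (t%:M : 'cV[R]_1) x))) s).
  exact: (@continuous_torus_integral m _ (fun (p : R * R) x => f p.1 (col_mx (p.2%:M : 'cV[R]_1)
      x)) (slice f cf)).
- exact: (@continuous_torus_integral m _ (fun (p : R * R) x => df p.1 (col_mx (p.2%:M : 'cV[R]_1)
    x)) (slice df cdf)).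
- move=> s t.
  exact: (IH (fun s x => f s (col_mx (t%:M : 'cV[R]_1) x)) (fun s x => df s (col_mx (t%:M :
      'cV[R]_1) x)) s
    (slice2 f t cf) (slice2 df t cdf) (fun s x => fdf s _)).
Qed.

Lemma torus_integral_shift (m : nat) (f : 'cV[R]_m -> R) (v : 'cV[R]_m) :
  continuous f -> Zperiodic f ->
  torus_integral (fun x => f (x + v)) = torus_integral f.
Proof.
elim: m f v => [|m IH] f v cf pf /=.
  by congr f; apply/matrixP => -[].
(* Translate the first variable and the remaining ones separately. *)
have [c [w ->]] : exists c w, v = col_mx (c%:M : 'cV[R]_1) w :> 'cV[R]_(1 + m).
  exists (v 0 0), (@dsubmx _ 1 m 1 v).
  rewrite -[LHS](@vsubmxK _ 1 m 1 v); congr col_mx; apply/matrixP => i j.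
  rewrite !mxE !ord1 eqxx mulr1n; congr (v _ _); exact: val_inj.
have sh t (x : 'cV[R]_m) : col_mx (t%:M : 'cV[R]_1) x + col_mx (c%:M : 'cV[R]_1) w
    = col_mx ((t + c)%:M : 'cV[R]_1) (x + w).
  by rewrite add_col_mx -raddfD.
have per (s : 'cV[R]_1) x (z1 : 'cV[int]_1) (z2 : 'cV[int]_m) :
    col_mx s x + map_mx intr (col_mx z1 z2) = col_mx (s + map_mx intr z1) (x + map_mx intr z2).
  by rewrite map_col_mx add_col_mx.
pose k t := torus_integral (fun x : 'cV[R]_m => f (col_mx (t%:M : 'cV[R]_1) x)).
rewrite -/(k _) -[RHS](@Rintegral01_shift R k c).
- apply: eq_Rintegral => t _; rewrite /k.
  under eq_fun do rewrite sh.
  rewrite (IH (fun x => f (col_mx ((t + c)%:M : 'cV[R]_1) x)))//.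
    exact: continuous_slice_at.
  move=> x z; rewrite -[RHS](pf _ (col_mx 0 z : 'cV[int]_(1 + m))).
  congr f; apply: etrans (esym (per _ _ _ _)).
  by rewrite map_mx0 addr0.
- by apply: (@continuous_torus_integral m _ (fun t x => f (col_mx (t%:M : 'cV[R]_1) x))); exact:
    continuous_slice.
- move=> t; rewrite /k; congr torus_integral; apply/funext => x.
  rewrite -[RHS](pf _ (col_mx 1%:M 0 : 'cV[int]_(1 + m))).
  congr f; apply: etrans (esym (per _ _ _ _)).
  by rewrite map_mx0 addr0 map_scalar_mx rmorph1 -raddfD.
Qed.

End torus.

(** * Averages over a product of two tori *)

(** The difference quotients on both sides are the same function of the increment. *)
Lemma is_derive_line (R : realType) (V W : normedModType R) (f : V -> W)
    (x v : V) (d : W) (t : R) :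
  is_derive (x + t *: v) v f d -> is_derive t (1 : R) (fun s => f (x + s *: v)) d.
Proof.
move=> [df <-].
have E : (fun h => h^-1 *: ((f \o shift (x + t *: v)) (h *: v) - f (x + t *: v)))
    = (fun h : R => h^-1 *: (((fun s => f (x + s *: v)) \o shift t) (h *: (1 : R)) - f (x + t *:
        v))).
  apply/funext => h /=; congr (_ *: (f _ - _)).
  by rewrite [h *: 1]mulr1 scalerDl addrCA.
by split; rewrite /derivable /derive -E.
Qed.

Section average.
Context (R : realType) (m l : nat).
Implicit Types f g df : 'cV[R]_m -> 'cV[R]_l -> R.

Definition jointly_continuous f :=
  continuous (fun q : 'cV[R]_m * 'cV[R]_l => f q.1 q.2).

Lemma continuous_inner_integral f : jointly_continuous f ->
  continuous (fun x => torus_integral (f x)).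
Proof. exact: continuous_torus_integral. Qed.

Lemma averageB f g : jointly_continuous f -> jointly_continuous g ->
  average (fun x y => f x y - g x y) = average f - average g.
Proof.
move=> cf cg; rewrite /average.
rewrite -torus_integralB; [|exact: continuous_inner_integral..].
congr torus_integral; apply/funext => x; apply: torus_integralB.
- exact: (continuous_section (f := f)).
- exact: (continuous_section (f := g)).
Qed.

Lemma average_shift f u w : jointly_continuous f ->
  (forall y, Zperiodic (f ^~ y)) -> (forall x, Zperiodic (f x)) ->
  average (fun x y => f (x + u) (y + w)) = average f.
Proof.
move=> cf p1 p2; rewrite /average.
rewrite -[RHS](@torus_integral_shift _ _ _ u).
- congr torus_integral; apply/funext => x; apply: torus_integral_shift => //.
  exact: (continuous_section (f := f)).
- exact: continuous_inner_integral.
- by move=> x k; congr torus_integral; apply/funext => y; exact: p1.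
Qed.

(** By translation invariance the average of f at the angles translated by h v is constant
in h; its derivative at h = 0 is the average of df. *)
Lemma average_derive f df (v : 'cV[R]_m * 'cV[R]_l) : jointly_continuous f -> jointly_continuous
    df ->
  (forall y, Zperiodic (f ^~ y)) -> (forall x, Zperiodic (f x)) ->
  (forall q, is_derive q v (fun q => f q.1 q.2) (df q.1 q.2)) ->
  average df = 0.
Proof.
move=> cf cdf p1 p2 fdf.
pose F (h : R) x y := f (x + h *: v.1) (y + h *: v.2).
pose dF (h : R) x y := df (x + h *: v.1) (y + h *: v.2).
have c1 (g : 'cV[R]_m -> 'cV[R]_l -> R) : jointly_continuous g ->
  continuous (fun p : (R * 'cV[R]_m) * 'cV[R]_l => g (p.1.2 + p.1.1 *: v.1) (p.2 + p.1.1 *: v.2)).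
  move=> cg; apply: (@continuous_pair2 _ _ _ _ g
     (fun p : (R * 'cV[R]_m) * 'cV[R]_l => p.1.2 + p.1.1 *: v.1) (fun p => p.2 + p.1.1 *: v.2)
         cg) => z.
    apply: cvgD; first by apply: (@continuous_comp _ _ _ fst snd); [exact: cvg_fst|exact: cvg_snd].
    apply: cvgZ; last exact: cvg_cst.
    by apply: (@continuous_comp _ _ _ fst fst); exact: cvg_fst.
  apply: cvgD; first exact: cvg_snd.
  apply: cvgZ; last exact: cvg_cst.
    by apply: (@continuous_comp _ _ _ fst fst); exact: cvg_fst.
have c2 (g : 'cV[R]_m -> 'cV[R]_l -> R) x : jointly_continuous g ->
  continuous (fun p : R * 'cV[R]_l => g (x + p.1 *: v.1) (p.2 + p.1 *: v.2)).
  move=> cg; apply: (@continuous_pair2 _ _ _ _ g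
     (fun p : R * 'cV[R]_l => x + p.1 *: v.1) (fun p => p.2 + p.1 *: v.2) cg) => z.
    by apply: cvgD; [exact: cvg_cst|apply: cvgZ; [exact: cvg_fst|exact: cvg_cst]].
  by apply: cvgD; [exact: cvg_snd|apply: cvgZ; [exact: cvg_fst|exact: cvg_cst]].
have dFF t x y : is_derive t (1 : R) (fun h => F h x y) (dF t x y).
  exact: (@is_derive_line _ _ _ (fun q => f q.1 q.2) (x, y) v _ t (fdf ((x, y) + t *: v))).
have din (t : R) x : is_derive t (1 : R) (fun h => torus_integral (F h x)) (torus_integral (dF t
    x)).
  exact: (@is_derive_torus_integral _ _ (fun h y => F h x y) (fun h y => dF h x y) t
    (c2 f x cf) (c2 df x cdf) (fun t y => dFF t x y)).
have dout : is_derive (0 : R) (1 : R) (fun h => average (F h)) (average (dF 0)).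
  apply: (@is_derive_torus_integral _ _ (fun h x => torus_integral (F h x))
    (fun h x => torus_integral (dF h x))) din.
    exact: (continuous_torus_integral (f := fun (p : R * 'cV[R]_m) y => F p.1 p.2 y) (c1 f cf)).
  exact: (continuous_torus_integral (f := fun (p : R * 'cV[R]_m) y => dF p.1 p.2 y) (c1 df cdf)).
have dF0 : dF 0 = df.
  by apply/funext => x; apply/funext => y; rewrite /dF !scale0r !addr0.
have Fcst : (fun h => average (F h)) = cst (average f).
  by apply/funext => h; exact: average_shift.
have dz : is_derive (0 : R) (1 : R) (cst (average f)) 0 by exact: is_derive_cst.
by case: dz => _ <-; case: dout => _; rewrite Fcst dF0 => ->.
Qed.

End average.

(** * Functions of class C^1 *)

(** Mean value inequality for curves in a normed module. The factor expR (2 * T) is not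
sharp: the estimate is only used with arbitrarily small c. *)
Lemma derivative_bound (R : realType) (V : normedModType R) (u du : R -> V) (T c : R) :
  0 <= T -> 0 <= c -> (forall t : R, 0 <= t <= T -> is_derive t 1 u (du t)) ->
  (forall t : R, 0 <= t <= T -> `|du t| <= c) ->
  `|u T - u 0| <= c * expR (2 * T).
Proof.
move=> T0 c0 udu duc; apply/ler_addgt0Pr => e e0.
have e'0 : 0 < e / expR (2 * T) by rewrite divr_gt0 ?expR_gt0.
have -> : c * expR (2 * T) + e = (c + e / expR (2 * T)) * expR ((0 + 2) * T).
  by rewrite add0r [(c + _) * _]mulrDl divfK// gt_eqF ?expR_gt0.
apply/ltW.
apply: (@gronwall R V (u - cst (u 0)) du T) => //.
- by rewrite !fctE subrr normr0 ltr_wpDl.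
- by move=> t tT; rewrite -[du t]subr0; apply: is_deriveB; exact: udu.
- by move=> t tT _; rewrite mul0r add0r; apply: (le_trans (duc _ tT)); rewrite lerDl ltW.
- by rewrite T0 lexx.
Qed.

Lemma is_derive_scale (R : realType) (W : normedModType R) (w : W) (t : R) :
  is_derive t (1 : R) (fun s => s *: w) w.
Proof.
have := @is_derive_line R W W id 0 w w t (is_derive_id _ _).
by congr is_derive; apply/funext => s; rewrite add0r.
Qed.

Section Ck1.
Context (R : realType) (V : normedModType R) (D : set V) (oD : open D).

Lemma continuous_eq_on (W : topologicalType) (f g : V -> W) x : D x ->
  (forall y, D y -> g y = f y) -> {for x, continuous g} -> {for x, continuous f}.
Proof.
move=> Dx gf cg; rewrite /prop_for /continuous_at -(gf x Dx).
apply: cvg_trans cg; apply: near_eq_cvg.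
by have : \forall y \near x, D y := open_nbhs_nbhs (conj oD Dx); apply: filterS.
Qed.

Lemma CkW (k : nat) (W : normedModType R) (f : V -> W) : Ck k.+1 D f -> Ck k D f.
Proof.
elim: k W f => [|k IH] W f [df dfk] /=.
  by move=> x Dx; apply: differentiable_continuous; exact: df.
by split => // v; apply: IH; exact: dfk.
Qed.

(** Computes the directional derivatives on D only; openness of D makes continuity of the
formula df equivalent to continuity of the derivative. *)
Lemma Ck1P (W : normedModType R) (f : V -> W) (df : V -> V -> W) :
  (forall x, D x -> differentiable f x) ->
  (forall x v, D x -> 'D_v f x = df v x) ->
  (forall v x, D x -> {for x, continuous (df v)}) -> Ck 1 D f.
Proof.
move=> d dE c; split => // v x Dx.
by apply: continuous_eq_on Dx _ (c v x Dx) => y Dy; rewrite dE.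
Qed.

Lemma Ck1_cst (W : normedModType R) (c : W) : Ck 1 D (cst c).
Proof.
apply: (@Ck1P _ _ (fun _ _ => 0)).
- by move=> x _; exact: differentiable_cst.
- by move=> x v _; exact: derive_cst.
- by move=> v x _; exact: cvg_cst.
Qed.

Lemma Ck1D (f g : V -> R) : Ck 1 D f -> Ck 1 D g -> Ck 1 D (f + g).
Proof.
move=> [df cf] [dg cg]; apply: (@Ck1P _ _ (fun v x => 'D_v f x + 'D_v g x)).
- by move=> x Dx; apply: differentiableD; [exact: df|exact: dg].
- move=> x v Dx; rewrite deriveD//; apply: diff_derivable; [exact: df|exact: dg].
- by move=> v x Dx; apply: cvgD; [exact: cf|exact: cg].
Qed.

Lemma Ck1N (f : V -> R) : Ck 1 D f -> Ck 1 D (- f).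
Proof.
move=> [df cf]; apply: (@Ck1P _ _ (fun v x => - 'D_v f x)).
- by move=> x Dx; apply: differentiableN; exact: df.
- by move=> x v Dx; rewrite deriveN//; apply: diff_derivable; exact: df.
- by move=> v x Dx; apply: cvgN; exact: cf.
Qed.

Lemma Ck1M (f g : V -> R) : Ck 1 D f -> Ck 1 D g -> Ck 1 D (f * g).
Proof.
move=> [df cf] [dg cg].
apply: (@Ck1P _ _ (fun v x => f x * 'D_v g x + g x * 'D_v f x)).
- by move=> x Dx; apply: differentiableM; [exact: df|exact: dg].
- move=> x v Dx; rewrite deriveM//; apply: diff_derivable; [exact: df|exact: dg].
- move=> v x Dx; apply: cvgD; apply: cvgM.
  + by apply: differentiable_continuous; exact: df.
  + exact: cg.
  + by apply: differentiable_continuous; exact: dg.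
  + exact: cf.
Qed.

Lemma Ck1V (f : V -> R) : (forall x, D x -> f x != 0) -> Ck 1 D f ->
  Ck 1 D (fun x => (f x)^-1).
Proof.
move=> f0 [df cf].
apply: (@Ck1P _ _ (fun v x => - (f x ^- 2) * 'D_v f x)).
- by move=> x Dx; apply: differentiableV; [exact: df|exact: f0].
- by move=> x v Dx; rewrite deriveV//; [exact: f0|apply: diff_derivable; exact: df].
- move=> v x Dx; apply: cvgM; last exact: cf.
  have cx : {for x, continuous f} by apply: differentiable_continuous; exact: df.
  by apply: cvgN; apply: cvgV; [rewrite sqrf_eq0 f0|rewrite expr2; apply: cvgM].
Qed.

Lemma Ck1_sum (I : Type) (r : seq I) (P : pred I) (F : I -> V -> R) :
  (forall i, Ck 1 D (F i)) -> Ck 1 D (fun x => \sum_(i <- r | P i) F i x).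
Proof.
move=> cF; elim: r => [|i r IH].
  rewrite (_ : (fun _ => _) = cst 0); first exact: Ck1_cst.
  by apply/funext => x; rewrite big_nil.
case Pi : (P i).
  rewrite (_ : (fun _ => _) = F i + (fun x => \sum_(j <- r | P j) F j x)).
    exact: (Ck1D (cF i) IH).
  by apply/funext => x; rewrite big_cons Pi.
by rewrite (_ : (fun _ => _) = (fun x => \sum_(j <- r | P j) F j x))//; apply/funext => x;
    rewrite big_cons Pi.
Qed.

Lemma Ck1_prod (I : Type) (r : seq I) (P : pred I) (F : I -> V -> R) :
  (forall i, Ck 1 D (F i)) -> Ck 1 D (fun x => \prod_(i <- r | P i) F i x).
Proof.
move=> cF; elim: r => [|i r IH].
  rewrite (_ : (fun _ => _) = cst 1); first exact: Ck1_cst.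
  by apply/funext => x; rewrite big_nil.
case Pi : (P i).
  rewrite (_ : (fun _ => _) = F i * (fun x => \prod_(j <- r | P j) F j x)).
    exact: (Ck1M (cF i) IH).
  by apply/funext => x; rewrite big_cons Pi.
by rewrite (_ : (fun _ => _) = (fun x => \prod_(j <- r | P j) F j x))//; apply/funext => x;
    rewrite big_cons Pi.
Qed.

Lemma Ck1_det (n : nat) (A : V -> 'M[R]_n) :
  (forall i j, Ck 1 D (fun x => A x i j)) -> Ck 1 D (fun x => \det (A x)).
Proof.
move=> cA; apply: Ck1_sum => s.
by apply: (@Ck1M (cst _)); [exact: Ck1_cst|exact: Ck1_prod].
Qed.

Lemma Ck1_cofactor (n : nat) (A : V -> 'M[R]_n) i j :
  (forall i j, Ck 1 D (fun x => A x i j)) -> Ck 1 D (fun x => cofactor (A x) i j).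
Proof.
move=> cA; apply: (@Ck1M (cst _)); first exact: Ck1_cst.
apply: Ck1_det => k p; have := cA (lift i k) (lift j p).
by congr (Ck 1 D _); apply/funext => x; rewrite !mxE.
Qed.

Lemma Ck1_entry (m n : nat) (f : V -> 'M[R]_(m, n)) i j :
  Ck 1 D f -> Ck 1 D (fun x => f x i j).
Proof.
move=> [df cf]; apply: (@Ck1P _ _ (fun v x => 'D_v f x i j)).
- move=> x Dx; apply: (@differentiable_comp _ _ _ _ f (fun M : 'M[R]_(m, n) => M i j)); first
    exact: df.
  exact: differentiable_coord.
- move=> x v Dx; rewrite derive_mx ?mxE//; apply: diff_derivable; exact: df.
- move=> v x Dx.
  apply: (@continuous_comp _ _ _ (fun x => 'D_v f x) (fun M : 'M[R]_(m, n) => M i j)); first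
      exact: cf.
  exact: coord_continuous.
Qed.

(** The two properties of the coordinates in a basis that turn bounds on finitely many
partial derivatives into bounds on the operator norm. *)
Definition coordinates (I : finType) (e : I -> V) (c : V -> I -> R) : Prop :=
  (forall v, v = \sum_i c v i *: e i) /\ (forall v i, `|c v i| <= `|v|).

(** Continuity of the finitely many partial derivatives gives continuity of the derivative
in operator norm, and the mean value inequality on the segment from z2 to z1 turns this
into the estimate on f z1 - f z2. *)
Lemma Ck1_strictly_C1 (W : normedModType R) (f : V -> W) (I : finType)
    (e : I -> V) (c : V -> I -> R) : coordinates e c ->
  Ck 1 D f -> strictly_C1 D f (fun x v => 'D_v f x).
Proof.
move=> [ce cn] [df cf].
have lin x : D x -> linear (fun v => 'D_v f x).
  by move=> Dx a u v; rewrite !deriveE ?linearP//; exact: df.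
have expand x v : D x -> 'D_v f x = \sum_i c v i *: 'D_(e i) f x.
  move=> Dx; rewrite [X in 'D_X f x]ce deriveE; last exact: df.
  by rewrite linear_sum; apply: eq_bigr => i _; rewrite linearZ deriveE//; exact: df.
have cont x (eps : R) : D x -> 0 < eps -> exists d : R, 0 < d /\
    forall x', `|x' - x| < d -> D x' /\ forall v, `|'D_v f x' - 'D_v f x| <= eps * `|v|.
  move=> Dx eps0; have n0 : 0 < eps / (#|I|%:R + 1).
    by rewrite divr_gt0// ltr_wpDl.
  have nD : \forall y \near x, D y := open_nbhs_nbhs (conj oD Dx).
  have ne : \forall y \near x, forall i, `|'D_(e i) f y - 'D_(e i) f x| < eps / (#|I|%:R + 1).
    apply: filter_forall => i.
    exact: (cvgr_distC_lt _ _ (cf (e i) x Dx)).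
  have /nbhs_ballP[d /= d0 hd] : \forall y \near x, D y /\ forall i,
      `|'D_(e i) f y - 'D_(e i) f x| < eps / (#|I|%:R + 1).
    by apply: filterS2 nD ne => y.
  exists d; split => // x' x'd; have := hd x'; rewrite -ball_normE/= distrC => /(_ x'd)[Dx' hx'].
  split => // v; rewrite expand// [in X in _ - X]expand// -sumrB.
  apply: (le_trans (ler_norm_sum _ _ _)).
  apply: (@le_trans _ _ (\sum_(i in I) eps / (#|I|%:R + 1) * `|v|)).
    apply: ler_sum => i _; rewrite -scalerBr normrZ mulrC.
    by apply: ler_pM => //; apply: ltW.
  rewrite sumr_const -[leLHS]mulr_natr mulrAC; apply: ler_wpM2r => //.
  by rewrite mulrAC ler_pdivrMr ?ltr_wpDl// ler_pM2l// lerDl ler01.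
split; first exact: lin.
- move=> x Dx; have [d [d0 hd]] := cont x 1 Dx ltr01.
  exists (\sum_i `|'D_(e i) f x| + 1), d; split => // x' /hd[Dx' hx'] v.
  rewrite -(subrK ('D_v f x) ('D_v f x')) mulrDl addrC.
  apply: (le_trans (ler_normD _ _)); apply: lerD; last exact: hx'.
  rewrite expand//; apply: (le_trans (ler_norm_sum _ _ _)).
  rewrite mulr_suml; apply: ler_sum => i _.
  by rewrite normrZ mulrC ler_wpM2l.
- move=> x Dx eps eps0.
  have e'0 : 0 < eps / (2 * expR 2) by rewrite divr_gt0// mulr_gt0// expR_gt0.
  have [d [d0 hd]] := cont x _ Dx e'0.
  exists d; split => // x' z1 z2 x'd z1d z2d.
  set v := z1 - z2.
  have seg (t : R) : 0 <= t <= 1 -> `|z2 + t *: v - x| < d.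
    move=> /andP[t0 t1].
    have -> : z2 + t *: v - x = (1 - t) *: (z2 - x) + t *: (z1 - x).
      have -> : v = (z1 - x) - (z2 - x) by rewrite /v opprB addrA subrK.
      by rewrite addrAC [t *: (_ - (z2 - x))]scalerBr scalerBl scale1r addrA addrAC.
    apply: (le_lt_trans (ler_normD _ _)); rewrite !normrZ !ger0_norm ?subr_ge0//.
    have [->|t_neq0] := eqVneq t 0; first by rewrite subr0 mul1r mul0r addr0.
    have t_gt0 : 0 < t by rewrite lt_neqAle eq_sym t_neq0.
    have a1 : (1 - t) * `|z2 - x| <= (1 - t) * d by rewrite ler_wpM2l ?subr_ge0// ltW.
    have a2 : t * `|z1 - x| < t * d by rewrite ltr_pM2l.
    by have := ler_ltD a1 a2; rewrite -mulrDl subrK mul1r.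
  pose u (t : R) := f (z2 + t *: v) - t *: 'D_v f x'.
  have uE : f z1 - f z2 - 'D_v f x' = u 1 - u 0.
    by rewrite /u !scale1r !scale0r addr0 subr0 /v addrCA subrr addr0 addrAC.
  have -> : eps * `|v| = eps / (2 * expR 2) * 2 * `|v| * expR (2 * 1).
    rewrite mulr1.
    by have := expR_gt0 (2 : R) => ?; field; rewrite gt_eqF.
  rewrite uE; apply: (@derivative_bound R W u (fun t => 'D_v f (z2 + t *: v) - 'D_v f x') 1).
  - exact: ler01.
  - by rewrite !mulr_ge0// ltW.
  - move=> t t01; apply: is_deriveB.
      apply: is_derive_line; apply: DeriveDef => //; apply: diff_derivable; apply: df.
      by apply: (hd _ _).1; exact: seg.
    exact: is_derive_scale.
  - move=> t t01; have [_ h1] := hd _ (seg t t01); have [_ h2] := hd _ x'd.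
    rewrite -(subrKA ('D_v f x)); apply: (le_trans (ler_normD _ _)).
    rewrite (distrC ('D_v f x)).
    have := h1 v; have := h2 v; lra.
Qed.

End Ck1.

(** * Strict differentiability of maps with several components *)

(** Finitely many conditions that persist under shrinking hold on a common radius. *)
Lemma common_radius (R : realType) (I : finType) (P : I -> R -> Prop) :
  (forall i d d', P i d -> d' <= d -> P i d') ->
  (forall i, exists d, 0 < d /\ P i d) -> exists d, 0 < d /\ forall i, P i d.
Proof.
move=> mono ex.
have n : \forall d \near 0^'+, forall i, P i d.
  apply: filter_forall => i; have [d [d0 Pd]] := ex i.
  near=> d'; apply: mono Pd _; near: d'; exact: nbhs_right_le.
near (0 : R)^'+ => d; exists d; split; last by near: d.
by near: d; exact: nbhs_right_gt.
Unshelve. all: by end_near. Qed.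

Section strict_closure.
Context (R : realType) (V : normedModType R) (D : set V).

Lemma mx_norm_entry (m n : nat) (M : 'M[R]_(m, n)) i j : `|M i j| <= `|M|.
Proof.
rewrite [leRHS]/Num.Def.normr/= mx_normrE.
exact: (le_bigmax _ (fun ij => `|M ij.1 ij.2|) (i, j)).
Qed.

Lemma mx_norm_le (m n : nat) (M : 'M[R]_(m, n)) (c : R) : 0 <= c ->
  (forall i j, `|M i j| <= c) -> `|M| <= c.
Proof.
move=> c0 hM; rewrite [leLHS]/Num.Def.normr/= mx_normrE.
by rewrite (bigmax_le _ c0)//= => -[i j] _ /=.
Qed.

Lemma strictly_C1_col (k : nat) (f : V -> 'cV[R]_k) (A : V -> V -> 'cV[R]_k) :
  (forall i, strictly_C1 D (fun x => f x i 0) (fun x v => A x v i 0)) ->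
  strictly_C1 D f A.
Proof.
move=> fA; split.
- move=> x Dx c u v; apply/matrixP => i j; rewrite ord1 !mxE.
  by have [lin _ _] := fA i; exact: lin.
- move=> x Dx.
  have /choice[C hC] : forall i, exists C : R, exists d : R, 0 < d /\
      forall x', `|x' - x| < d -> forall v, `|A x' v i 0| <= C * `|v|.
    by move=> i; have [_ b _] := fA i; exact: b.
  have [d [d0 hd]] := common_radius (P := fun i (d : R) =>
      forall x', `|x' - x| < d -> forall v, `|A x' v i 0| <= C i * `|v|)
    (fun i d d' h dd' x' x'd => h x' (lt_le_trans x'd dd')) hC.
  exists (\sum_i `|C i|), d; split => // x' x'd v; apply: mx_norm_le => [|i j].
    by rewrite mulr_ge0// sumr_ge0.
  rewrite ord1; apply: (le_trans (hd i x' x'd v)); rewrite ler_wpM2r//.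
  rewrite (bigD1 i)//= (le_trans (ler_norm _))// lerDl sumr_ge0//.
- move=> x Dx e e0.
  have [d [d0 hd]] := common_radius (P := fun i (d : R) => forall x' z1 z2,
      `|x' - x| < d -> `|z1 - x| < d -> `|z2 - x| < d ->
      `|f z1 i 0 - f z2 i 0 - A x' (z1 - z2) i 0| <= e * `|z1 - z2|)
    (fun i d d' h dd' x' z1 z2 h1 h2 h3 =>
      h x' z1 z2 (lt_le_trans h1 dd') (lt_le_trans h2 dd') (lt_le_trans h3 dd'))
    (fun i => let: And3 _ _ s := fA i in s x Dx e e0).
  exists d; split => // x' z1 z2 h1 h2 h3; apply: mx_norm_le => [|i j].
    by rewrite mulr_ge0// ltW.
  by rewrite ord1 !mxE; exact: hd.
Qed.

Lemma pair_norm_le (V1 V2 : normedModType R) (p : V1 * V2) (c : R) :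
  `|p.1| <= c -> `|p.2| <= c -> `|p| <= c.
Proof. by move=> h1 h2; rewrite /Num.Def.normr /= ge_max h1 h2. Qed.

Lemma pair_norm_fst (V1 V2 : normedModType R) (p : V1 * V2) : `|p.1| <= `|p|.
Proof. by rewrite [leRHS]/Num.Def.normr /= le_max lexx. Qed.

Lemma pair_norm_snd (V1 V2 : normedModType R) (p : V1 * V2) : `|p.2| <= `|p|.
Proof. by rewrite [leRHS]/Num.Def.normr /= le_max lexx orbT. Qed.

Lemma strictly_C1_pair (W1 W2 : normedModType R) (f : V -> W1) (g : V -> W2)
    (A : V -> V -> W1) (B : V -> V -> W2) :
  strictly_C1 D f A -> strictly_C1 D g B ->
  strictly_C1 D (fun x => (f x, g x)) (fun x v => (A x v, B x v)).
Proof.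
move=> [lA bA sA] [lB bB sB]; split.
- by move=> x Dx c u v; rewrite lA// lB.
- move=> x Dx; have [C1 [d1 [d10 h1]]] := bA x Dx; have [C2 [d2 [d20 h2]]] := bB x Dx.
  exists (Num.max C1 C2), (Num.min d1 d2); rewrite lt_min d10 d20; split => // x'.
  rewrite lt_min => /andP[x'1 x'2] v; apply: pair_norm_le => /=.
    by apply: (le_trans (h1 x' x'1 v)); rewrite ler_wpM2r// le_max lexx.
  by apply: (le_trans (h2 x' x'2 v)); rewrite ler_wpM2r// le_max lexx orbT.
- move=> x Dx e e0; have [d1 [d10 h1]] := sA x Dx e e0; have [d2 [d20 h2]] := sB x Dx e e0.
  exists (Num.min d1 d2); rewrite lt_min d10 d20; split => // x' z1 z2.
  rewrite !lt_min => /andP[? ?] /andP[? ?] /andP[? ?].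
  by apply: pair_norm_le => /=; [exact: h1|exact: h2].
Qed.

Lemma strictly_C1_cst (W : normedModType R) (c : W) :
  strictly_C1 D (fun=> c) (fun _ _ => 0).
Proof.
split.
- by move=> x Dx a u v; rewrite scaler0 addr0.
- by move=> x Dx; exists 0, 1; split => // x' _ v; rewrite normr0 mul0r.
- move=> x Dx e e0; exists 1; split => // x' z1 z2 _ _ _.
  by rewrite subrr subr0 normr0 mulr_ge0// ltW.
Qed.

End strict_closure.

Lemma strictly_C1_comp_fst (R : realType) (V S W : normedModType R) (D : set V)
    (f : V -> W) (A : V -> V -> W) : strictly_C1 D f A ->
  strictly_C1 (D `*` [set: S]) (fun p => f p.1) (fun p v => A p.1 v.1).
Proof.
move=> [lA bA sA]; split.
- by move=> x [Dx _] c u v; rewrite /= lA.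
- move=> x [Dx _]; have [C [d [d0 h]]] := bA _ Dx; exists (Num.max C 0), d; split => // x' x'd v.
  apply: (le_trans (h x'.1 (le_lt_trans (pair_norm_fst (x' - x)) x'd) v.1)).
  apply: (@le_trans _ _ (Num.max C 0 * `|v.1|)).
    by rewrite ler_wpM2r// le_max lexx.
  by rewrite ler_wpM2l ?pair_norm_fst// le_max lexx orbT.
- move=> x [Dx _] e e0; have [d [d0 h]] := sA _ Dx _ e0; exists d; split => // x' z1 z2 h1 h2 h3.
  have f1 (p : V * S) : `|p| < d -> `|p.1| < d := le_lt_trans (pair_norm_fst p).
  apply: (le_trans (h x'.1 z1.1 z2.1 (f1 _ h1) (f1 _ h2) (f1 _ h3))).
  by rewrite ler_wpM2l ?(ltW e0)// (pair_norm_fst (z1 - z2)).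
Qed.

Lemma coordinates_cV_prod (R : realType) (m l : nat) :
  coordinates (fun i : 'I_m + 'I_l => match i with
      | inl i => (delta_mx i 0, 0) | inr j => (0, delta_mx j 0) end : 'cV[R]_m * 'cV[R]_l)
    (fun v i => match i with inl i => v.1 i 0 | inr j => v.2 j 0 end).
Proof.
split=> [[v w]|[v w] [i|j]] /=; last 2 first.
- exact: le_trans (mx_norm_entry _ _ _) (pair_norm_fst (v, w)).
- exact: le_trans (mx_norm_entry _ _ _) (pair_norm_snd (v, w)).
have cE k (z : 'cV[R]_k) : z = \sum_i z i 0 *: delta_mx i 0.
  rewrite [LHS]matrix_sum_delta; apply: eq_bigr => i _.
  by rewrite big_ord1.
rewrite big_sumType /=.
have -> : \sum_i v i 0 *: (delta_mx i 0, 0) = (v, 0) :> 'cV[R]_m * 'cV[R]_l.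
  rewrite [in RHS](cE _ v); elim/big_ind2 : _ => // [x1 [x2 x3] y1 y2 -> ->|i _].
    by rewrite /GRing.add /= /add_pair/= addr0.
  by rewrite /GRing.scale /= /scale_pair/= scaler0.
have -> : \sum_i w i 0 *: (0, delta_mx i 0) = (0, w) :> 'cV[R]_m * 'cV[R]_l.
  rewrite [in RHS](cE _ w); elim/big_ind2 : _ => // [x1 [x2 x3] y1 y2 -> ->|i _].
    by rewrite /GRing.add /= /add_pair/= addr0.
  by rewrite /GRing.scale /= /scale_pair/= scaler0.
by congr (_, _); rewrite ?addr0 ?add0r.
Qed.

Lemma is_derive_comp_curve (R : realType) (V W : normedModType R) (f : V -> W)
    (y : R -> V) (t : R) (d : V) :
  differentiable f (y t) -> is_derive t (1 : R) y d ->
  is_derive t (1 : R) (fun s => f (y s)) ('D_d f (y t)).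
Proof.
move=> df [/derivable1_diffP dy dE].
have dfy : differentiable (f \o y) t by exact: differentiable_comp.
apply: DeriveDef; first by apply/derivable1_diffP.
rewrite deriveE// diff_comp//= [RHS]deriveE//; congr ('d f (y t) _).
by rewrite -deriveE.
Qed.

Lemma Ck1_comp_fst (R : realType) (V S W : normedModType R) (D : set V)
    (f : V -> W) : open D -> Ck 1 D f ->
  Ck 1 (D `*` [set: S]) (fun p => f p.1).
Proof.
move=> oD [df cf]; split.
- move=> x [Dx _]; apply: (@differentiable_comp _ _ _ _ (fst : V * S -> V) f); last exact: df.
  by apply: linear_differentiable => z; exact: cvg_fst.
- move=> v x [Dx _].
  apply: (@continuous_comp _ _ _ (fst : V * S -> V) (fun x => 'D_(v.1) f x)); first exact: cvg_fst.
  exact: cf.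
Qed.

(** * Directional derivatives with a moving base point *)

Section directional_quotient.
Context (R : realType) (Q W : normedModType R).
Implicit Types (f : Q -> W) (q v : Q) (l : W).

Definition difference_quotient f v (i : Q * R) : W :=
  i.2^-1 *: (f (i.1 + i.2 *: v) - f i.1).

Definition base_and_step q : set_system (Q * R) := filter_prod (nbhs q) 0^'.

#[export] Instance base_and_step_filter q : ProperFilter (base_and_step q).
Proof. exact: filter_prod_proper. Qed.

(** The base point of the quotient moves together with the step. This is stronger than
is_derive, and it is what makes the derivative continuous and additive. *)
Definition strict_derivative f q v l :=
  difference_quotient f v i @[i --> base_and_step q] --> l.

Lemma base_and_step_neq0 q : \forall i \near base_and_step q, i.2 != 0.
Proof.
exists (setT, [set h | h != 0]) => /=; last by case=> x h [].
by split; [exact: filterT|exact: withinT].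
Qed.

Lemma base_and_step_fst q : i.1 @[i --> base_and_step q] --> q.
Proof. exact: cvg_fst. Qed.

Lemma base_and_step_endpoint q v : i.1 + i.2 *: v @[i --> base_and_step q] --> q.
Proof.
rewrite -[X in _ --> X]addr0 -(scale0r v); apply: cvgD; first exact: cvg_fst.
apply: cvgZ; last exact: cvg_cst.
apply: (@cvg_trans _ 0^'); first exact: cvg_snd.
exact: nbhs_dnbhs.
Qed.

Lemma strictly_C1_strict_derivative f A q v : strictly_C1 setT f A ->
  strict_derivative f q v (A q v).
Proof.
move=> [lin _ strict]; apply/cvgrPdist_le => e e0.
have e'0 : 0 < e / (`|v| + 1) by rewrite divr_gt0// ltr_wpDl.
have [d [d0 hd]] := strict q I _ e'0.
near=> i.
have i2 : i.2 != 0 by near: i; exact: base_and_step_neq0.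
have d1 : `|i.1 - q| < d.
  by near: i; exact: (cvgr_distC_lt _ _ (@base_and_step_fst q)).
have d2 : `|i.1 + i.2 *: v - q| < d.
  by near: i; exact: (cvgr_distC_lt _ _ (@base_and_step_endpoint q v)).
have := hd q (i.1 + i.2 *: v) i.1; rewrite subrr normr0 => /(_ d0 d2 d1).
have -> : i.1 + i.2 *: v - i.1 = i.2 *: v by rewrite addrAC subrr add0r.
rewrite (linear_scale (lin q I)) normrZ => h.
rewrite distrC /difference_quotient -[A q v](scalerK i2) -scalerBr normrZ normfV.
rewrite mulrC ler_pdivrMr ?normr_gt0//; apply: (le_trans h).
rewrite [X in _ * X]mulrC mulrA ler_wpM2r//.
by rewrite mulrAC ler_pdivrMr ?ltr_wpDl// ler_wpM2l ?(ltW e0)// lerDl.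
Unshelve. all: by end_near. Qed.

Lemma strict_derivative_is_derive f q v l :
  strict_derivative f q v l -> is_derive q v f l.
Proof.
move=> fl.
have h : h^-1 *: ((f \o shift q) (h *: v) - f q) @[h --> 0^'] --> l.
  apply: cvg_trans fl.
  have : (fun h : R => (q, h)) @ 0^' --> base_and_step q.
    exact: (@cvg_pair _ _ _ 0^' (nbhs q) 0^' _ _ _ (fun=> q) id (cvg_cst q) cvg_id).
  move=> /(cvg_app (difference_quotient f v)) lim; apply: (cvg_trans _ lim).
  apply: near_eq_cvg; near=> h.
  by rewrite /difference_quotient /= [q + _]addrC.
split; first by apply/cvg_ex; exists l.
exact: cvg_lim h.
Unshelve. all: by end_near. Qed.

(** The quotient based at a point close to q is close to df q, and it tends to df at that
point as the step goes to 0. *)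
Lemma strict_derivative_continuous f v (df : Q -> W) :
  (forall q, strict_derivative f q v (df q)) -> continuous df.
Proof.
move=> fdf q; apply/cvgrPdist_le => e e0.
have e20 : 0 < e / 2 by rewrite divr_gt0.
have [[A B] /= [nA nB] hAB] := (cvgrPdist_le _ _).1 (fdf q) _ e20.
near=> q1.
have Aq1 : A q1 by near: q1.
have : \forall i \near base_and_step q1, `|df q1 - difference_quotient f v i| <= e / 2.
  exact: (cvgrPdist_le _ _).1 (fdf q1) _ e20.
move=> [[A1 B1] /= [nA1 nB1] hAB1].
have [h [Bh B1h]] : exists h, B h /\ B1 h.
  exact: (filter_ex (filterI nB nB1)).
have h1 := hAB (q1, h) (conj Aq1 Bh).
have h2 := hAB1 (q1, h) (conj (nbhs_singleton nA1) B1h).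
rewrite -(subrKA (difference_quotient f v (q1, h))).
apply: (le_trans (ler_normD _ _)); rewrite [X in _ + X]distrC.
by move: h1 h2 => /=; lra.
Unshelve. all: by end_near. Qed.

(** The quotient in direction u + v is the sum of the quotient in direction u and of the
quotient in direction v based at the endpoint of the first increment; moving base points
make the second one converge as well. *)
Lemma strict_derivativeD f q u v a b : strict_derivative f q u a ->
  strict_derivative f q v b -> strict_derivative f q (u + v) (a + b).
Proof.
move=> fa fb.
have shift : (fun i : Q * R => (i.1 + i.2 *: u, i.2)) @ base_and_step q --> base_and_step q.
  exact: (@cvg_pair _ _ _ (base_and_step q) (nbhs q) 0^' _ _ _ _ _
    (@base_and_step_endpoint q u) cvg_snd).
have fb' : difference_quotient f v (i.1 + i.2 *: u, i.2) @[i --> base_and_step q] --> b.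
  exact: cvg_comp shift fb.
have sum : difference_quotient f u i + difference_quotient f v (i.1 + i.2 *: u, i.2)
    @[i --> base_and_step q] --> a + b by exact: cvgD.
rewrite /strict_derivative; apply: (cvg_trans _ sum); apply: near_eq_cvg; near=> i.
rewrite /difference_quotient /= -scalerDr; congr (_ *: _).
by rewrite [LHS]addrC scalerDr [i.1 + (_ + _)]addrA subrKA.
Unshelve. all: by end_near. Qed.

Lemma is_deriveZ_direction f q v l c :
  is_derive q v f l -> is_derive q (c *: v) f (c *: l).
Proof.
move=> fl; have [->|c0] := eqVneq c 0.
  by rewrite !scale0r; split; [exact: derivable0|exact: derive0].
move: fl => [/cvg_ex[l' fl'] dl].
have ll' : l = l' by rewrite -dl; exact: cvg_lim fl'.
rewrite {}ll' {dl}.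
have h : h^-1 *: ((f \o shift q) (h *: (c *: v)) - f q) @[h --> 0^'] --> c *: l'.
  have sc : (fun h : R => h * c) @ 0^' --> 0^'.
    move=> A nA; change (nbhs (0 : R) [set h | h != 0 -> A (h * c)]).
    have ct : (fun h : R => h * c) @ (0 : R) --> (0 : R).
      have := is_derive_continuous (is_derive_scale (c : R^o) 0).
      by rewrite /prop_for /continuous_at scale0r.
    have nA' : \forall h \near (0 : R), h * c != 0 -> A (h * c).
      exact: (ct [set h | h != 0 -> A h] nA).
    by apply: filterS nA' => x /= Ax x0; apply: Ax; rewrite mulf_neq0.
  have lim : c *: ((h * c)^-1 *: ((f \o shift q) ((h * c) *: v) - f q)) @[h --> 0^'] --> c *: l'.
    by apply: cvgZ; [exact: cvg_cst|exact: cvg_comp sc fl'].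
  apply: (cvg_trans _ lim); apply: near_eq_cvg; near=> h.
  by rewrite /= [h *: (c *: v)]scalerA [c *: (_ *: _)]scalerA invfM mulrCA mulfV// mulr1.
split; first by apply/cvg_ex; exists (c *: l').
exact: cvg_lim h.
Unshelve. all: by end_near. Qed.

End directional_quotient.

Lemma cauchy_quotient_cvg (R : realType) (Q : normedModType R) (f : Q -> R) (q v : Q) :
  (forall e : R, 0 < e -> exists N, base_and_step q N /\ forall i j, N i -> N j ->
     `|difference_quotient f v i - difference_quotient f v j| <= e) ->
  exists l, strict_derivative f q v l.
Proof.
move=> cau; apply/cvg_ex; apply: cauchy_cvg.
apply/cauchyP => e e0.
have [N [bN hN]] := cau (e / 2) (divr_gt0 e0 (ltr0Sn _ 1)).
have [i Ni] := filter_ex bN.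
exists (difference_quotient f v i); apply: filterS bN => j Nj.
rewrite /= -ball_normE /=; apply: le_lt_trans (hN i j Ni Nj) _.
by rewrite ltr_pdivrMr// ltr_pMr// ltr1n.
Qed.

(** Entrywise, so that only completeness of the real line is used. *)
Lemma cauchy_quotient_cvg_cV (R : realType) (Q : normedModType R) (k : nat)
    (f : Q -> 'cV[R]_k) (q v : Q) :
  (forall e : R, 0 < e -> exists N, base_and_step q N /\ forall i j, N i -> N j ->
     `|difference_quotient f v i - difference_quotient f v j| <= e) ->
  exists l, strict_derivative f q v l.
Proof.
move=> cau.
have /choice[L hL] : forall a, exists l, strict_derivative (fun q => f q a 0) q v l.
  move=> a; apply: cauchy_quotient_cvg => e /cau[N [bN hN]].
  exists N; split => // i j Ni Nj; apply: le_trans (hN i j Ni Nj).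
  by apply: le_trans (mx_norm_entry _ a 0); rewrite !mxE.
exists (\col_a L a); apply: cvg_mx => a b; rewrite ord1 mxE.
have -> : (fun i => difference_quotient f v i a 0) = difference_quotient (fun q => f q a 0) v.
  by apply/funext => i; rewrite /difference_quotient !mxE.
exact: hL.
Qed.

(** The Jacobian matrix only records derivatives along the canonical basis; additivity of the
directional derivative is what recovers all other directions, without Frechet
differentiability of f. *)
Lemma jac_mulmx (R : realType) (m k : nat) (f : 'cV[R]_m -> 'cV[R]_k) x
    (L : 'cV[R]_m -> 'cV[R]_k) (w : 'cV[R]_m) :
  (forall v, is_derive x v f (L v)) -> (forall u v, L (u + v) = L u + L v) ->
  jac f x *m w = L w.
Proof.
move=> fL LD.
have LZ c v : L (c *: v) = c *: L v.
  by have [_ <-] := fL (c *: v); have [_ <-] := is_deriveZ_direction c (fL v).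
have L0 : L 0 = 0 by rewrite -(scale0r 0) LZ scale0r.
have Lsum (I : finType) (F : I -> 'cV[R]_m) : L (\sum_i F i) = \sum_i L (F i).
  exact: (big_morph L LD L0).
have -> : w = \sum_i w i 0 *: delta_mx i 0.
  by rewrite [LHS]matrix_sum_delta; apply: eq_bigr => i _; rewrite big_ord1.
rewrite Lsum mulmx_sumr; apply: eq_bigr => i _; rewrite LZ -scalemxAr; congr (_ *: _).
apply/matrixP => a b; rewrite !ord1 !mxE (bigD1 i)//= !mxE !eqxx mulr1 big1 => [|j /negbTE ji].
  by rewrite addr0; have [_ ->] := fL (delta_mx i 0).
by rewrite !mxE ji mulr0.
Qed.

(** * Derivatives of pairs, of entries and of scalar products *)

Lemma is_derive_pair (R : realType) (V W1 W2 : normedModType R) (f : V -> W1)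
    (g : V -> W2) (x v : V) (a : W1) (b : W2) :
  is_derive x v f a -> is_derive x v g b ->
  is_derive x v (fun t => (f t, g t)) (a, b).
Proof.
move=> [/cvg_ex[a' fa] aE] [/cvg_ex[b' gb] bE].
have {}aE : a = a' by rewrite -aE; exact: cvg_lim fa.
have {}bE : b = b' by rewrite -bE; exact: cvg_lim gb.
subst a' b'.
have h : h^-1 *: (((fun t => (f t, g t)) \o shift x) (h *: v) - (f x, g x)) @[h --> 0^'] --> (a, b).
  exact: (cvg_pair fa gb).
split; first by apply/cvg_ex; exists (a, b).
exact: cvg_lim h.
Qed.

Lemma is_derive_fst (R : realType) (V W1 W2 : normedModType R) (f : V -> W1 * W2)
    (x v : V) (d : W1 * W2) :
  is_derive x v f d -> is_derive x v (fun t => (f t).1) d.1.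
Proof.
move=> [/cvg_ex[d' fd] dE]; have {}dE : d = d' by rewrite -dE; exact: cvg_lim fd.
subst d'; have h : h^-1 *: (((fun t => (f t).1) \o shift x) (h *: v) - (f x).1) @[h --> 0^'] -->
    d.1.
  exact: (@cvg_comp _ _ _ _ fst _ _ _ fd cvg_fst).
split; first by apply/cvg_ex; exists d.1.
exact: cvg_lim h.
Qed.

Lemma is_derive_snd (R : realType) (V W1 W2 : normedModType R) (f : V -> W1 * W2)
    (x v : V) (d : W1 * W2) :
  is_derive x v f d -> is_derive x v (fun t => (f t).2) d.2.
Proof.
move=> [/cvg_ex[d' fd] dE]; have {}dE : d = d' by rewrite -dE; exact: cvg_lim fd.
subst d'; have h : h^-1 *: (((fun t => (f t).2) \o shift x) (h *: v) - (f x).2) @[h --> 0^'] -->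
    d.2.
  exact: (@cvg_comp _ _ _ _ snd _ _ _ fd cvg_snd).
split; first by apply/cvg_ex; exists d.2.
exact: cvg_lim h.
Qed.

Lemma is_derive_entry (R : realType) (V : normedModType R) (m n : nat)
    (f : V -> 'M[R]_(m, n)) (x v : V) (d : 'M[R]_(m, n)) i j :
  is_derive x v f d -> is_derive x v (fun t => f t i j) (d i j).
Proof.
move=> [fd <-]; split; first by move/derivable_mxP : fd.
by rewrite derive_mx// mxE.
Qed.

Definition dot (R : realType) (N : nat) (u w : 'cV[R]_N) : R :=
  \sum_k u k 0 * w k 0.

Lemma is_derive_dot (R : realType) (V : normedModType R) (N : nat)
    (f g : V -> 'cV[R]_N) (x v : V) (df dg : 'cV[R]_N) :
  is_derive x v f df -> is_derive x v g dg ->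
  is_derive x v (fun t => dot (f t) (g t)) (dot df (g x) + dot (f x) dg).
Proof.
move=> fd gd.
have -> : (fun t => dot (f t) (g t)) = \sum_k ((fun t => f t k 0) * (fun t => g t k 0)).
  by apply/funext => t; rewrite fct_sumE.
have -> : dot df (g x) + dot (f x) dg = \sum_k (f x k 0 *: dg k 0 + g x k 0 *: df k 0).
  rewrite /dot -big_split; apply: eq_bigr => k _ /=.
  by rewrite addrC [df k 0 * _]mulrC.
apply: is_derive_sum => k; apply: is_deriveM; exact: is_derive_entry.
Qed.

Lemma dot_mulmx (R : realType) (N : nat) (u w : 'cV[R]_N) : dot u w = (u^T *m w) 0 0.
Proof. by rewrite mxE; apply: eq_bigr => k _; rewrite mxE. Qed.

Lemma dotC (R : realType) (N : nat) (u w : 'cV[R]_N) : dot u w = dot w u.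
Proof. by apply: eq_bigr => k _; rewrite mulrC. Qed.

(** The value of the gradient g on r, computed from Omega X = g^T with Omega = J^T - J. *)
Lemma skew_gradient (R : realType) (N : nat) (J : 'M[R]_N) (X r : 'cV[R]_N)
    (g : 'rV[R]_N) : (J^T - J) *m X = g^T ->
  (g *m r) 0 0 = dot (J *m r) X - dot (J *m X) r.
Proof.
move=> /(congr1 trmx); rewrite trmxK => <-.
rewrite dotC !dot_mulmx !trmx_mul raddfB /= trmxK mulmxBr mulmxBl.
by rewrite !mulmxA !mxE.
Qed.

Lemma derive_partial_fst (R : realType) (V S W : normedModType R) (f : V -> S -> W) z s v :
  'D_v (f ^~ s) z = 'D_(v, 0) (fun p : V * S => f p.1 p.2) (z, s).
Proof.
have E : (fun h : R => h^-1 *: (((f ^~ s) \o shift z) (h *: v) - f z s)) =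
    (fun h : R => h^-1 *: (((fun p : V * S => f p.1 p.2) \o shift (z, s)) (h *: (v, 0)) - f z s)).
  by apply/funext => h /=; rewrite scaler0 add0r.
by rewrite /derive E.
Qed.

Lemma is_derive_partial_fst (R : realType) (V S W : normedModType R) (f : V * S -> W) z s v d :
  is_derive (z, s) (v, 0) f d -> is_derive z v (fun z => f (z, s)) d.
Proof.
move=> [df <-].
have E : (fun h : R => h^-1 *: ((f \o shift (z, s)) (h *: (v, 0)) - f (z, s))) =
    (fun h : R => h^-1 *: (((fun z => f (z, s)) \o shift z) (h *: v) - f (z, s))).
  apply/funext => h /=; congr (_ *: (f _ - _)).
  by congr (_, _); rewrite /= scaler0 add0r.
by split; rewrite /derivable /derive -E.
Qed.

Lemma is_derive_partial_snd (R : realType) (V S W : normedModType R) (f : V * S -> W) z s w d :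
  is_derive (z, s) (0, w) f d -> is_derive s w (fun s => f (z, s)) d.
Proof.
move=> [df <-].
have E : (fun h : R => h^-1 *: ((f \o shift (z, s)) (h *: (0, w)) - f (z, s))) =
    (fun h : R => h^-1 *: (((fun s => f (z, s)) \o shift s) (h *: w) - f (z, s))).
  apply/funext => h /=; congr (_ *: (f _ - _)).
  by congr (_, _); rewrite /= scaler0 add0r.
by split; rewrite /derivable /derive -E.
Qed.

Lemma differentiable_is_derive (R : realType) (V W : normedModType R) (f : V -> W) x v :
  differentiable f x -> is_derive x v f ('D_v f x).
Proof. by move=> df; split => //; exact: diff_derivable. Qed.

Lemma jac_differentiable (R : realType) (m k : nat) (f : 'cV[R]_m -> 'cV[R]_k) x v :
  differentiable f x -> jac f x *m v = 'D_v f x.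
Proof.
move=> df; apply: (@jac_mulmx _ _ _ _ _ (fun v => 'D_v f x)).
  by move=> w; exact: differentiable_is_derive.
by move=> u w; rewrite !deriveE// linearD.
Qed.

Lemma jac_scalar_mulmx (R : realType) (m : nat) (f : 'cV[R]_m -> R) x v :
  differentiable f x -> (jac_scalar f x *m v) 0 0 = 'D_v f x.
Proof.
move=> df; have -> : 'D_v f x = 'D_(\sum_i v i 0 *: delta_mx i 0) f x.
  congr ('D__ f x); rewrite [LHS]matrix_sum_delta; apply: eq_bigr => i _.
  by rewrite big_ord1.
rewrite deriveE// linear_sum mxE; apply: eq_bigr => i _.
by rewrite linearZ mxE /= deriveE// mulrC.
Qed.

(** * The Hamiltonian vector field and its Lagrangian *)

Lemma dotDr (R : realType) (N : nat) (u v w : 'cV[R]_N) :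
  dot u (v + w) = dot u v + dot u w.
Proof. by rewrite !dot_mulmx mulmxDr mxE. Qed.

Lemma dot_norm_le (R : realType) (N : nat) (u v : 'cV[R]_N) (A B : R) :
  `|u| <= A -> `|v| <= B -> `|dot u v| <= N%:R * A * B.
Proof.
move=> uA vB; apply: (le_trans (ler_norm_sum _ _ _)).
apply: (@le_trans _ _ (\sum_(k < N) A * B)).
  apply: ler_sum => k _; rewrite normrM.
  by apply: ler_pM => //; [exact: le_trans (mx_norm_entry _ _ _) uA|exact: le_trans
      (mx_norm_entry _ _ _) vB].
by rewrite sumr_const card_ord -[leLHS]mulr_natl mulrA.
Qed.

Section field.
Context (R : realType) (N l : nat) (U : set 'cV[R]_N) (oU : open U).
Context (a : 'cV[R]_N -> 'cV[R]_N) (ha : Ck 2 U a).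
Context (hOmega : forall z, U z -> Omega a z \in unitmx).
Context (H : 'cV[R]_N -> 'cV[R]_l -> R).
Context (hH : Ck 2 (U `*` [set: 'cV[R]_l]) (fun p => H p.1 p.2)).

Notation X1 := ('cV[R]_N * 'cV[R]_l)%type.
Notation Hp := (fun p : X1 => H p.1 p.2).
Notation D1 := (U `*` [set: 'cV[R]_l]).

(** X_H with the inverse of Omega written through its adjugate: the entries are visibly
sums of products and quotients of C^1 functions. *)
Definition hamiltonian_field (p : X1) : 'cV[R]_N :=
  \col_i \sum_k (\det (Omega a p.1))^-1 * cofactor (Omega a p.1) k i
    * 'D_(delta_mx k 0, 0) Hp p.

Definition lagrangian (p : X1) : R := dot (a p.1) (hamiltonian_field p) - H p.1 p.2.

Lemma open_domain : open D1.
Proof.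
have -> : D1 = (fun p : X1 => p.1) @^-1` U by apply/seteqP; split => p /=; tauto.
by apply: open_comp => // p _; exact: cvg_fst.
Qed.

Lemma XH_field z phi : U z -> XH a H z phi = hamiltonian_field (z, phi).
Proof.
move=> Uz; apply/matrixP => i j; rewrite ord1 /XH !mxE; apply: eq_bigr => k _.
by rewrite /invmx hOmega// !mxE derive_partial_fst.
Qed.

Lemma differentiable_a z : U z -> differentiable a z.
Proof. by case: ha => d _; exact: d. Qed.

Lemma differentiable_H p : D1 p -> differentiable Hp p.
Proof. by case: hH => d _; exact: d. Qed.

Lemma Ck1_field i : Ck 1 D1 (fun p => hamiltonian_field p i 0).
Proof.
have cO j k : Ck 1 D1 (fun p : X1 => Omega a p.1 j k).
  apply: (@Ck1_comp_fst _ _ _ _ U (fun z => Omega a z j k) oU).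
  have cj i1 j1 : Ck 1 U (fun z => jac a z i1 j1).
    have -> : (fun z => jac a z i1 j1) = (fun z => 'D_(delta_mx j1 0) a z i1 0).
      by apply/funext => z; rewrite mxE.
    have [_ da] := ha; apply: (Ck1_entry oU); exact: da.
  have -> : (fun z => Omega a z j k) = (fun z => jac a z k j) + - (fun z => jac a z j k).
    by apply/funext => z; rewrite !fctE !mxE.
  by apply: (Ck1D oU) => //; apply: (Ck1N oU).
have -> : (fun p => hamiltonian_field p i 0) = (fun p => \sum_k (\det (Omega a p.1))^-1 *
    cofactor (Omega a p.1) k i * 'D_(delta_mx k 0, 0) Hp p).
  by apply/funext => p; rewrite mxE.
apply: Ck1_sum; first exact: open_domain.
move=> k; apply: (@Ck1M _ _ _ open_domain (fun p => (\det (Omega a p.1))^-1 * cofactor (Omega a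
    p.1) k i)).
  apply: (@Ck1M _ _ _ open_domain (fun p => (\det (Omega a p.1))^-1)).
    apply: (@Ck1V _ _ _ open_domain); last by apply: (Ck1_det open_domain).
    by move=> p [Up _]; have := hOmega Up; rewrite unitmxE unitfE.
  exact: (Ck1_cofactor open_domain).
by have [_ dH] := hH; exact: dH.
Qed.

Lemma Ck1_a_comp k : Ck 1 D1 (fun p : X1 => a p.1 k 0).
Proof.
apply: (@Ck1_comp_fst _ _ _ _ U (fun z => a z k 0) oU).
exact: (Ck1_entry oU _ _ (CkW ha)).
Qed.

Lemma Ck1_lagrangian : Ck 1 D1 lagrangian.
Proof.
have -> : lagrangian = (fun p => \sum_k a p.1 k 0 * hamiltonian_field p k 0) + - Hp by [].
apply: (Ck1D open_domain); last by apply: (Ck1N open_domain); exact: (CkW hH).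
apply: (Ck1_sum open_domain) => k.
by apply: (Ck1M open_domain); [exact: Ck1_a_comp|exact: Ck1_field].
Qed.

Lemma derive_lagrangian p v : D1 p ->
  'D_v lagrangian p = dot ('D_(v.1) a p.1) (hamiltonian_field p) +
    dot (a p.1) (\col_k 'D_v (fun p => hamiltonian_field p k 0) p) - 'D_v Hp p.
Proof.
move=> Dp; apply: derive_val; apply: is_deriveB.
  apply: is_derive_dot.
    have := @differentiable_is_derive _ _ _ (fun p : X1 => a p.1) p v.
    apply; apply: (@differentiable_comp _ _ _ _ (fst : X1 -> _) a).
      by apply: linear_differentiable => z; exact: cvg_fst.
    by apply: differentiable_a; case: Dp.
  have dk k : derivable (fun p => hamiltonian_field p k 0) p v.
    by apply: diff_derivable; case: (Ck1_field k) => d _; exact: d.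
  split; first by apply/derivable_mxP => i j; rewrite ord1.
  rewrite derive_mx; last by apply/derivable_mxP => i j; rewrite ord1.
  by apply/matrixP => i j; rewrite ord1 !mxE.
by apply: differentiable_is_derive; exact: differentiable_H.
Qed.

Lemma field_equation z phi : U z ->
  Omega a z *m hamiltonian_field (z, phi) = (jac_scalar (H ^~ phi) z)^T.
Proof. by move=> Uz; rewrite -XH_field// /XH mulmxA mulmxV ?mul1mx// hOmega. Qed.

Context (alpha : 'cV[R]_l).

Lemma differentiable_H_partial z phi : U z -> differentiable (H ^~ phi) z.
Proof.
move=> Uz; apply: (@differentiable_comp _ _ _ _ (fun z => (z, phi)) Hp).
  apply: differentiable_pair; last exact: differentiable_cst.
  by case: (is_diff_id z).
exact: differentiable_H.
Qed.

Lemma derive_H_split z phi r c : U z ->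
  'D_(r, c *: alpha) Hp (z, phi) =
    (jac_scalar (H ^~ phi) z *m r) 0 0 + c * 'D_(0, alpha) Hp (z, phi).
Proof.
move=> Uz; rewrite jac_scalar_mulmx; last exact: differentiable_H_partial.
rewrite derive_partial_fst !deriveE; try exact: differentiable_H.
have -> : (r, c *: alpha) = (r, 0) + c *: (0, alpha) :> X1.
  by congr (_, _); rewrite /= ?scaler0 ?addr0 ?add0r.
by rewrite linearD linearZ.
Qed.

(** The Euler-Lagrange equation: the variation of a . x' - H in the direction
(r, c alpha) reduces to a total time derivative. The last term is the time derivative of
c H along the trajectory, in which D_z H X vanishes by skew-symmetry of Omega. *)
Lemma action_balance z phi r c : U z -> let X := hamiltonian_field (z, phi) in
  dot ('D_X a z) r - dot ('D_r a z) X + 'D_(r, c *: alpha) Hp (z, phi)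
    - c * 'D_(X, alpha) Hp (z, phi) = 0.
Proof.
move=> Uz X; have dz := differentiable_a Uz.
rewrite -!jac_differentiable// derive_H_split// -[alpha in X in _ - _ * X]scale1r.
rewrite derive_H_split// !(skew_gradient _ (field_equation phi Uz)) -/X; ring.
Qed.

(** The left-hand side is the time derivative of a . r - s - c H along the trajectory when
the variations r of the position and s of the action satisfy the linearized equations up
to errors e1 and e2: only the errors survive. *)
Lemma action_defect z phi (r e1 : 'cV[R]_N) (c e2 : R) : U z ->
  let X := hamiltonian_field (z, phi) in let rho := (r, c *: alpha) in
  dot ('D_X a z) r
    + dot (a z) (\col_k 'D_rho (fun p => hamiltonian_field p k 0) (z, phi) + e1)
    - ('D_rho lagrangian (z, phi) + e2) - c * 'D_(X, alpha) Hp (z, phi)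
  = dot (a z) e1 - e2.
Proof.
move=> Uz X rho; have bal := action_balance phi r c Uz.
rewrite derive_lagrangian// dotDr /=.
move: bal; rewrite -/X -/rho /=.
move: ('D_rho _ _) (dot (a z) (\col__ _)) (dot _ r) (dot _ X) (c * _) (dot _ e1) => p1 p2 p3 p4
    p5 p6.
lra.
Qed.

(** Phase and action are carried along as components of the state: the equation becomes
autonomous, and derivatives of the action come from the same perturbation theorem as
derivatives of the position. *)
Definition extended_field (y : X1 * R) : X1 * R :=
  ((hamiltonian_field y.1, alpha), lagrangian y.1).

Definition extended_jacobian (y v : X1 * R) : X1 * R :=
  ((\col_k 'D_(v.1) (fun p => hamiltonian_field p k 0) y.1, 0), 'D_(v.1) lagrangian y.1).

Lemma strictly_C1_extended_field :
  strictly_C1 (D1 `*` [set: R]) extended_field extended_jacobian.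
Proof.
apply: (@strictly_C1_comp_fst R X1 R (X1 * R)%type D1
  (fun p => ((hamiltonian_field p, alpha), lagrangian p))
  (fun p v => ((\col_k 'D_v (fun p => hamiltonian_field p k 0) p, 0), 'D_v lagrangian p))).
apply: strictly_C1_pair.
  apply: strictly_C1_pair; last exact: strictly_C1_cst.
  apply: strictly_C1_col => i.
  have := Ck1_strictly_C1 open_domain (coordinates_cV_prod R N l) (Ck1_field i).
  by congr strictly_C1; apply/funext => x; apply/funext => v; rewrite mxE.
exact: (Ck1_strictly_C1 open_domain (coordinates_cV_prod R N l) Ck1_lagrangian).
Qed.

End field.

(** * First variation of the action along a family of trajectories *)

Lemma cvg_dot (R : realType) (N : nat) (I : Type) (F : set_system I) (FF : Filter F)
    (b u : 'cV[R]_N) (f : I -> 'cV[R]_N) :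
  f i @[i --> F] --> u -> dot b (f i) @[i --> F] --> dot b u.
Proof.
move=> fu; apply/cvgrPdist_le => e e0.
have p : 0 < N%:R * `|b| + 1 by rewrite ltr_wpDl// mulr_ge0.
have e'0 : 0 < e / (N%:R * `|b| + 1) by rewrite divr_gt0.
near=> i.
have -> : dot b u - dot b (f i) = dot b (u - f i).
  by rewrite !dot_mulmx mulmxBr !mxE.
have h : `|u - f i| <= e / (N%:R * `|b| + 1).
  by near: i; exact: (cvgrPdist_le _ _).1 fu _ e'0.
apply: (le_trans (dot_norm_le (lexx _) h)).
by rewrite mulrA ler_pdivrMr// mulrC ler_pM2l// lerDl.
Unshelve. all: by end_near. Qed.

Section family.
Context (R : realType) (N l m : nat) (U : set 'cV[R]_N) (oU : open U).
Context (a : 'cV[R]_N -> 'cV[R]_N) (ha : Ck 2 U a).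
Context (hOmega : forall z, U z -> Omega a z \in unitmx).
Context (H : 'cV[R]_N -> 'cV[R]_l -> R).
Context (hH : Ck 2 (U `*` [set: 'cV[R]_l]) (fun p => H p.1 p.2)).
Context (alpha : 'cV[R]_l) (T : R) (T0 : 0 <= T).

Notation Q := ('cV[R]_m * 'cV[R]_l)%type.
Notation X1 := ('cV[R]_N * 'cV[R]_l)%type.
Notation Hp := (fun p : X1 => H p.1 p.2).

Context (K : Q -> 'cV[R]_N) (hK : Ck 1 setT K).
Context (x : Q -> R -> 'cV[R]_N) (s : Q -> R -> R).
Context (x_start : forall q, x q 0 = K q) (s_start : forall q, s q 0 = 0).
Context (xU : forall q (t : R), 0 <= t <= T -> U (x q t)).
Context (x_eq : forall q (t : R), 0 <= t <= T ->
  is_derive t (1 : R) (x q) (hamiltonian_field a H (x q t, q.2 + t *: alpha))).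
Context (s_eq : forall q (t : R), 0 <= t <= T ->
  is_derive t (1 : R) (s q) (lagrangian a H (x q t, q.2 + t *: alpha))).

Definition extended_trajectory q t : X1 * R := ((x q t, q.2 + t *: alpha), s q t).
Local Notation y := extended_trajectory.
Local Notation G := (extended_field a H alpha).
Local Notation DG := (extended_jacobian a H).

Lemma extended_solution q : is_solution G T (y q).
Proof.
move=> t tT; apply: is_derive_pair; last exact: s_eq.
apply: is_derive_pair; first exact: x_eq.
rewrite -[X in is_derive _ _ _ X]add0r; apply: is_deriveD; exact: is_derive_scale.
Qed.

Let strict := strictly_C1_extended_field oU ha hOmega hH alpha.

Let yD q t : 0 <= t <= T -> ((U `*` [set: 'cV[R]_l]) `*` [set: R]) (y q t).
Proof. by move=> tT; split => //; split => //; exact: xU. Qed.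

(** The phase and the action contribute v.2 and 0: the trajectory starts at phase q.2 with
action 0. *)
Lemma start_strict_derivative q v :
  strict_derivative (fun q => y q 0) q v (('D_v K q, v.2), 0).
Proof.
have sK : strictly_C1 setT K (fun q v => 'D_v K q).
  exact: (Ck1_strictly_C1 openT (coordinates_cV_prod R m l) hK).
have -> : (fun q => y q 0) = (fun q => ((K q, q.2), 0)).
  by apply/funext => q'; rewrite /y x_start s_start scale0r addr0.
apply: (@strictly_C1_strict_derivative _ _ _ _ (fun q v => (('D_v K q, v.2), 0))).
apply: strictly_C1_pair; last exact: strictly_C1_cst.
apply: strictly_C1_pair => //; split => //.
- by move=> q' _; exists 1, 1; split => // x' _ v'; rewrite mul1r pair_norm_snd.
- move=> q' _ e e0; exists 1; split => // x' z1 z2 _ _ _.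
  by rewrite subrr normr0 mulr_ge0// ltW.
Qed.

Lemma continuous_start : continuous (fun q => y q 0).
Proof.
have -> : (fun q => y q 0) = (fun q => ((K q, q.2), 0)).
  by apply/funext => q'; rewrite /y x_start s_start scale0r addr0.
move=> q'.
have cK : {for q', continuous K}.
  by apply: differentiable_continuous; case: hK => d _; exact: d.
exact: (cvg_pair (cvg_pair cK cvg_snd) (cvg_cst (0 : R))).
Qed.

Lemma continuous_endpoint : continuous (fun q => y q T).
Proof.
move=> q; have [L [d [L0 d0 close _]]] :=
  solutions_remain_close strict (@yD q) (extended_solution q) T0.
apply/cvgrPdist_lt => e e0.
(* Half of the admissible initial distance leaves room for the strict inequalities. *)
pose c := Num.min e d / L / 2.
have c0 : 0 < c by rewrite !divr_gt0// lt_min e0.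
have cL : c * L = Num.min e d / 2 by rewrite /c mulrAC divfK ?gt_eqF.
have m0 : 0 < Num.min e d by rewrite lt_min e0.
have me : Num.min e d <= e by rewrite ge_min lexx.
have md : Num.min e d <= d by rewrite ge_min lexx orbT.
near=> q'.
have qq' : `|y q' 0 - y q 0| < c.
  by near: q'; exact: (cvgr_distC_lt _ _ (@continuous_start q)).
have cd : c * L < d by rewrite cL; lra.
have TT : 0 <= T <= T by rewrite T0 lexx.
rewrite distrC; apply: lt_trans (close _ _ (extended_solution q') qq' cd T TT) _.
by rewrite cL; lra.
Unshelve. all: by end_near. Qed.

Section direction.
Context (q v : Q).

Let r (i : Q * R) t := i.2^-1 *: (y (i.1 + i.2 *: v) t - y i.1 t).
Let dr (i : Q * R) t := i.2^-1 *: (G (y (i.1 + i.2 *: v) t) - G (y i.1 t)).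

Let cvg1 : y i.1 0 @[i --> base_and_step q] --> y q 0.
Proof. exact: (cvg_comp _ _ (@base_and_step_fst _ _ q) (@continuous_start q)). Qed.

Let cvg2 : y (i.1 + i.2 *: v) 0 @[i --> base_and_step q] --> y q 0.
Proof. exact: (cvg_comp _ _ (@base_and_step_endpoint _ _ q v) (@continuous_start q)). Qed.

Lemma endpoint_cauchy (e : R) : 0 < e -> exists N, base_and_step q N /\
  forall i j, N i -> N j -> `|r i T - r j T| <= e.
Proof.
move=> e0.
have := @quotient_cauchy R _ _ _ _ strict T (y q) (@yD q) (extended_solution q)
  (Q * R)%type (base_and_step q) _ (fun i => y i.1) (fun i => y (i.1 + i.2 *: v)) snd _
  (fun i => extended_solution i.1) (fun i => extended_solution (i.1 + i.2 *: v))
  (@base_and_step_neq0 _ _ q) cvg1 cvg2 (@start_strict_derivative q v) T0 e e0.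
exact.
Qed.

(** Difference quotients of the endpoint are quotients of solutions at time T, hence
Cauchy. *)
Lemma endpoint_strict_derivative : exists l, strict_derivative (fun q => x q T) q v l.
Proof.
apply: cauchy_quotient_cvg_cV => e e0; have [B [bB hB]] := endpoint_cauchy e0.
exists B; split => // i j Bi Bj; apply: le_trans (hB i j Bi Bj).
exact: le_trans (pair_norm_fst _) (pair_norm_fst (r i T - r j T)).
Qed.

Lemma action_strict_derivative : exists l, strict_derivative (fun q => s q T) q v l.
Proof.
apply: cauchy_quotient_cvg => e e0; have [B [bB hB]] := endpoint_cauchy e0.
exists B; split => // i j Bi Bj; apply: le_trans (hB i j Bi Bj).
exact: (pair_norm_snd (r i T - r j T)).
Qed.

Context (c : R) (vc : v.2 = c *: alpha).

Let S (i : Q * R) t := dot (a (x q t)) (r i t).1.1 - (r i t).2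
  - c * H (x q t) (q.2 + t *: alpha).

Let X t := hamiltonian_field a H (x q t, q.2 + t *: alpha).

Let dS (i : Q * R) t :=
  dot ('D_(X t) a (x q t)) (r i t).1.1 + dot (a (x q t)) (dr i t).1.1 - (dr i t).2
  - c * 'D_(X t, alpha) Hp (x q t, q.2 + t *: alpha).

Let is_derive_S i t : 0 <= t <= T -> is_derive t (1 : R) (S i) (dS i t).
Proof.
move=> tT.
have dri : is_derive t (1 : R) (r i) (dr i t).
  by apply: is_deriveZ; apply: is_deriveB; exact: extended_solution.
apply: is_deriveB.
  apply: is_deriveB; last exact: (is_derive_snd dri).
  apply: is_derive_dot; last exact: (is_derive_fst (is_derive_fst dri)).
  apply: is_derive_comp_curve; last exact: x_eq.
  by apply: (differentiable_a ha); exact: xU.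
apply: is_deriveZ.
apply: (@is_derive_comp_curve _ _ _ Hp (fun t => (x q t, q.2 + t *: alpha))).
  by apply: (differentiable_H hH); split => //; exact: xU.
exact: (is_derive_fst (extended_solution q tT)).
Qed.

Let dS_small : exists B : R, forall e : R, 0 < e ->
  \forall i \near base_and_step q, forall t : R, 0 <= t <= T -> `|dS i t| <= B * e.
Proof.
have [M [M0 hM]] := quotient_linearized strict (@yD q) (extended_solution q) _
  (fun i => extended_solution i.1) (fun i => extended_solution (i.1 + i.2 *: v))
  (@base_and_step_neq0 _ _ q) cvg1 cvg2 (@start_strict_derivative q v) T0.
have [A hA] : exists A : R, forall t : R, 0 <= t <= T -> `|a (x q t)| <= A.
  have cn : {within `[0, T], continuous (fun t => `|a (x q t)|)}.
    apply: continuous_in_subspaceT => t; rewrite inE/= in_itv/= => tT.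
    apply: cvg_norm; apply: (@continuous_comp _ _ _ (x q) a).
      exact: is_derive_continuous (x_eq q tT).
    by apply: differentiable_continuous; apply: (differentiable_a ha); exact: xU.
  have [t0 _ ht0] := EVT_max T0 cn; exists `|a (x q t0)| => t tT.
  by apply: ht0; rewrite in_itv.
exists (N%:R * A + 1) => e e0.
apply: (@filterS2 _ _ (base_and_step_filter q) _ _ _ _ (base_and_step_neq0 q) (hM e e0)).
move=> i i0 hi t tT; have [_] : `|r i t| <= M /\ `|dr i t - DG (y q t) (r i t)| <= e.
  exact: hi.
set err := dr i t - _ => erre.
(* All phases run at the same speed, so their difference quotient is constant in time. *)
have r2 : (r i t).1 = ((r i t).1.1, c *: alpha).
  rewrite [LHS]surjective_pairing; congr (_, _).
  rewrite /r /= opprD addrACA subrr addr0 vc addrAC subrr add0r.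
  exact: scalerK.
have tU : U (x q t) by exact: xU.
have Dt : (U `*` [set: 'cV[R]_l]) (x q t, q.2 + t *: alpha) by [].
have pair11 (p p' : X1 * R) : p.1.1 = p'.1.1 + (p - p').1.1.
  by rewrite /= [RHS]addrC subrK.
have pair2 (p p' : X1 * R) : p.2 = p'.2 + (p - p').2.
  by rewrite /= [RHS]addrC subrK.
have r'E : (dr i t).1.1 = \col_k 'D_((r i t).1) (fun p => hamiltonian_field a H p k 0) (x q t,
    q.2 + t *: alpha) + err.1.1.
  exact: (pair11 (dr i t) (DG (y q t) (r i t))).
have r''E : (dr i t).2 = 'D_((r i t).1) (lagrangian a H) (x q t, q.2 + t *: alpha) + err.2.
  exact: (pair2 (dr i t) (DG (y q t) (r i t))).
have -> : dS i t = dot (a (x q t)) err.1.1 - err.2.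
  rewrite /dS r'E r''E r2 /=; exact: (action_defect oU ha hOmega hH).
clear r'E r''E; clearbody err; apply: (le_trans (ler_normB _ _)).
rewrite mulrDl mul1r lerD//; last exact: le_trans (pair_norm_snd err) erre.
apply: dot_norm_le; first exact: hA.
exact: le_trans (pair_norm_fst _) (le_trans (pair_norm_fst err) erre).
Qed.



(** The quantity S = a(x) . r - (variation of the action) - c H, where r is a difference
quotient of trajectories, has a time derivative that tends to 0 with the step
(dS_small). Its values at times 0 and T therefore have the same limit, which is the
asserted equality. *)
Lemma action_identity lx ls :
  strict_derivative (fun q => x q T) q v lx ->
  strict_derivative (fun q => s q T) q v ls ->
  dot (a (x q T)) lx - ls - c * H (x q T) (q.2 + T *: alpha)
    = dot (a (K q)) ('D_v K q) - c * H (K q) q.2.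
Proof.
move=> xl sl.
have end_lim : S i T @[i --> base_and_step q] -->
    dot (a (x q T)) lx - ls - c * H (x q T) (q.2 + T *: alpha).
  by apply: cvgB; [apply: cvgB; [exact: cvg_dot|exact: sl]|exact: cvg_cst].
have start_lim : S i 0 @[i --> base_and_step q] -->
    dot (a (x q 0)) ('D_v K q) - 0 - c * H (x q 0) (q.2 + 0 *: alpha).
  have st := @start_strict_derivative q v.
  apply: cvgB; last exact: cvg_cst.
  apply: cvgB; last exact: (@cvg_comp _ _ _ _ snd _ _ _ st cvg_snd).
  apply: cvg_dot; apply: (@cvg_comp _ _ _ _ fst _ _ _ _ cvg_fst).
    exact: (@cvg_comp _ _ _ _ fst _ _ _ st cvg_fst).
  exact: nbhs_filter.
have zero_lim : S i T - S i 0 @[i --> base_and_step q] --> (0 : R).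
  have [B hB] := dS_small; apply/cvgrPdist_le => e e0.
  have Bp : 0 < `|B| + 1 by rewrite ltr_wpDl.
  have E0 : 0 < expR (2 * T) := expR_gt0 _.
  have e'0 : 0 < e / ((`|B| + 1) * expR (2 * T)) by rewrite divr_gt0// mulr_gt0.
  apply: (@filterS _ _ (base_and_step_filter q) _ _ _ (hB _ e'0)) => i h.
  rewrite sub0r normrN.
  apply: (@le_trans _ _ ((`|B| + 1) * (e / ((`|B| + 1) * expR (2 * T))) * expR (2 * T))).
    apply: (@derivative_bound _ _ (S i) (dS i)) => //.
    - by rewrite mulr_ge0// ltW.
    - exact: is_derive_S.
    - move=> t tT; apply: (le_trans (h t tT)); rewrite ler_wpM2r ?(ltW e'0)//.
      by apply: (le_trans (ler_norm _)); rewrite lerDl.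
  by rewrite le_eqVlt; apply/orP; left; apply/eqP; field; rewrite !gt_eqF.
have diff_lim : S i T - S i 0 @[i --> base_and_step q] -->
    (dot (a (x q T)) lx - ls - c * H (x q T) (q.2 + T *: alpha)) -
    (dot (a (x q 0)) ('D_v K q) - 0 - c * H (x q 0) (q.2 + 0 *: alpha)).
  exact: cvgB.
apply/eqP; rewrite -subr_eq0; apply/eqP.
move: diff_lim; rewrite x_start subr0 scale0r addr0 => diff_lim.
exact: (norm_cvg_unique (V := R^o) diff_lim zero_lim).
Qed.

End direction.
End family.

(** * The time-T map of the evolution operator *)

(** Integrating from a point of J to the left of 0 makes the primitive differentiable at
the endpoint 0 as well; the constant is then adjusted. *)
Lemma primitive_exists (R : realType) (J : set R) (f : R -> R) (T : R) :
  is_interval J -> open J -> J 0 -> J T -> 0 <= T ->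
  (forall t, J t -> {for t, continuous f}) ->
  exists F : R -> R, F 0 = 0 /\
    forall t : R, 0 <= t <= T -> is_derive t (1 : R) F (f t).
Proof.
move=> iJ oJ J0 JT T0 cf.
have /nbhs_ballP[r /= r0 hr] : nbhs (0 : R) J by exact: open_nbhs_nbhs (conj oJ J0).
have /nbhs_ballP[u /= u0 hu] : nbhs T J by exact: open_nbhs_nbhs (conj oJ JT).
have Jl : J (- (r / 2)).
  by apply: hr; rewrite -ball_normE/= sub0r opprK gtr0_norm; lra.
have Jr : J (T + u / 2).
  apply: hu; rewrite -ball_normE/= opprD addrA subrr sub0r normrN gtr0_norm; lra.
pose P x := \int[@lebesgue_measure R]_(t in `[- (r / 2), x]) f t.
have int : (@lebesgue_measure R).-integrable `[- (r / 2), T + u / 2] (EFin \o f).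
  apply: continuous_compact_integrable; first exact: segment_compact.
  apply: continuous_in_subspaceT => t; rewrite inE/= in_itv/= => tI.
  by apply: cf; exact: iJ Jl Jr _ tI.
have dP (t : R) : 0 <= t <= T -> is_derive t (1 : R) P (f t).
  move=> /andP[t0 tT].
  have tu : t < T + u / 2 by lra.
  have lt : - (r / 2) < t by lra.
  have Jt : J t by apply: iJ J0 JT _ _; rewrite t0.
  have [d e] := continuous_FTC1_closed tu int lt (cf t Jt).
  by split; [exact: d|rewrite -derive1E; exact: e].
clearbody P; exists (fun t => P t - P 0); split; first by rewrite subrr.
move=> t tT; rewrite -[f t]subr0; apply: is_deriveB; exact: dP.
Qed.

Lemma derive_translate (R : realType) (V W : normedModType R) (f : V -> W) (k q v : V) :
  (forall q, f (q + k) = f q) -> 'D_v f (q + k) = 'D_v f q.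
Proof.
move=> fk.
have E : (fun h : R => h^-1 *: ((f \o shift (q + k)) (h *: v) - f (q + k))) =
    (fun h : R => h^-1 *: ((f \o shift q) (h *: v) - f q)).
  by apply/funext => h /=; rewrite addrA !fk.
by rewrite /derive E.
Qed.

Section flow.
Context (R : realType) (N l m : nat) (U : set 'cV[R]_N) (oU : open U).
Context (a : 'cV[R]_N -> 'cV[R]_N) (ha : Ck 2 U a).
Context (hOmega : forall z, U z -> Omega a z \in unitmx).
Context (hatalpha : 'cV[R]_l) (H : 'cV[R]_N -> 'cV[R]_l -> R).
Context (hH : Ck 2 (U `*` [set: 'cV[R]_l]) (fun p => H p.1 p.2)).
Context (hHper : forall z, U z -> Zperiodic (H z)).
Context (flow : R -> 'cV[R]_N -> 'cV[R]_l -> 'cV[R]_N).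
Context (hflow : evolution_operator U a H hatalpha flow).
Context (T : R) (T0 : 0 <= T).
Context (K : 'cV[R]_m -> 'cV[R]_l -> 'cV[R]_N).
Context (hK : Ck 1 setT (fun p : 'cV[R]_m * 'cV[R]_l => K p.1 p.2)).
Context (hKper1 : forall phi, Zperiodic (K ^~ phi)).
Context (hKper2 : forall theta, Zperiodic (K theta)).
Context (hKU : forall theta phi, U (K theta phi)).
Context (hKT : forall theta phi,
  maximal_interval U a H hatalpha (K theta phi) phi T).

Notation Q := ('cV[R]_m * 'cV[R]_l)%type.
Let Kp (q : Q) := K q.1 q.2.
Let x (q : Q) t := flow t (Kp q) q.2.

Lemma field_periodic z phi (k : 'cV[int]_l) : U z ->
  hamiltonian_field a H (z, phi + map_mx intr k) = hamiltonian_field a H (z, phi).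
Proof.
move=> Uz; rewrite -!(XH_field hOmega)// /XH; congr (_ *m _^T).
apply/matrixP => i j; rewrite !mxE; apply: near_eq_derive.
have : \forall z' \near z, U z' := open_nbhs_nbhs (conj oU Uz).
by apply: filterS => z' Uz'; exact: hHper.
Qed.

Lemma lagrangian_periodic z phi (k : 'cV[int]_l) : U z ->
  lagrangian a H (z, phi + map_mx intr k) = lagrangian a H (z, phi).
Proof. by move=> Uz; rewrite /lagrangian field_periodic//= hHper. Qed.

Let interval_in q t : 0 <= t <= T -> maximal_interval U a H hatalpha (Kp q) q.2 t.
Proof.
by have [iJ _ J0 _ _] := hflow q.2 (hKU q.1 q.2); exact: iJ J0 (hKT _ _) _.
Qed.

Let on_interval q t : maximal_interval U a H hatalpha (Kp q) q.2 t ->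
  U (x q t) /\ is_derive t (1 : R) (x q) (hamiltonian_field a H (x q t, q.2 + t *: hatalpha)).
Proof.
have [_ _ _ _ sol] := hflow q.2 (hKU q.1 q.2) => /sol[Ux dx].
by rewrite -(XH_field hOmega).
Qed.

(** The action is a primitive of the Lagrangian along the trajectory, on the open interval
where the trajectory exists. *)
Lemma action_exists : exists s : Q -> R -> R, (forall q, s q 0 = 0) /\
  forall q (t : R), 0 <= t <= T ->
    is_derive t (1 : R) (s q) (lagrangian a H (x q t, q.2 + t *: hatalpha)).
Proof.
suff /choice[s hs] : forall q, exists s : R -> R, s 0 = 0 /\ forall t : R, 0 <= t <= T ->
    is_derive t (1 : R) s (lagrangian a H (x q t, q.2 + t *: hatalpha)).
  by exists s; split => q; have [] := hs q.
move=> q; have [iJ oJ J0 _ _] := hflow q.2 (hKU q.1 q.2).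
apply: (primitive_exists iJ oJ J0 (hKT _ _) T0) => t Jt.
have [Ux dx] := on_interval Jt.
apply: (@continuous_comp _ _ _ (fun t => (x q t, q.2 + t *: hatalpha)) (lagrangian a H)).
  have c1 : {for t, continuous (x q)} := is_derive_continuous dx.
  have c2 : {for t, continuous (fun t : R => q.2 + t *: hatalpha)}.
    apply: cvgD; first exact: cvg_cst.
    exact: is_derive_continuous (is_derive_scale hatalpha t).
  exact: (cvg_pair c1 c2).
apply: differentiable_continuous.
by have [d _] := Ck1_lagrangian oU ha hOmega hH; exact: d.
Qed.

(** Everything about the dynamics that the averaging argument needs. Periodicity holds
because the angle-shifted trajectory solves the same initial value problem, H being
periodic in the phase. *)
Theorem endpoint_calculus : exists (p : Q -> R) (dF : Q -> Q -> 'cV[R]_N) (dp : Q -> Q -> R),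
  let F q := flow T (Kp q) q.2 in
  [/\ (forall q, U (F q)) /\ continuous F /\ continuous p,
      (forall v, continuous (dF v)) /\ (forall v, continuous (dp v)),
      (forall v q, strict_derivative F q v (dF v q)) /\
      (forall v q, is_derive q v p (dp v q)),
      (forall (k1 : 'cV[int]_m) (k2 : 'cV[int]_l) q,
        F (q + (map_mx intr k1, map_mx intr k2)) = F q /\
        p (q + (map_mx intr k1, map_mx intr k2)) = p q) &
      forall v c q, v.2 = c *: hatalpha ->
        dot (a (F q)) (dF v q) - dp v q - c * H (F q) (q.2 + T *: hatalpha)
          = dot (a (Kp q)) ('D_v Kp q) - c * H (Kp q) q.2].
Proof.
have [s [s0 hs]] := action_exists.
have TT : 0 <= T <= T by rewrite T0 lexx.
have x0 q : x q 0 = Kp q.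
  by have [_ _ _ x0 _] := hflow q.2 (hKU q.1 q.2).
have xU q (t : R) : 0 <= t <= T -> U (x q t).
  by move=> tT; have [] := on_interval (interval_in q tT).
have dx q (t : R) : 0 <= t <= T ->
    is_derive t (1 : R) (x q) (hamiltonian_field a H (x q t, q.2 + t *: hatalpha)).
  by move=> tT; have [] := on_interval (interval_in q tT).
have cF := continuous_endpoint oU ha hOmega hH T0 hK x0 s0 xU dx hs.
have /choice[dF hdF] : forall v : Q, exists d : Q -> 'cV[R]_N, forall q : Q,
    strict_derivative (fun q => x q T) q v (d q).
  move=> v; suff /choice[d hd] : forall q : Q, exists l, strict_derivative (fun q => x q T) q v l
      by exists d.
  move=> q.
  exact: (endpoint_strict_derivative oU ha hOmega hH T0 hK x0 s0 xU dx hs).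
have /choice[dp hdp] : forall v : Q, exists d : Q -> R, forall q : Q,
    strict_derivative (fun q => s q T) q v (d q).
  move=> v; suff /choice[d hd] : forall q : Q, exists l, strict_derivative (fun q => s q T) q v l
      by exists d.
  move=> q.
  exact: (action_strict_derivative oU ha hOmega hH T0 hK x0 s0 xU dx hs).
exists (fun q => s q T), dF, dp; split.
- pose yT q := extended_trajectory hatalpha x s q T.
  split => [q|]; first exact: xU.
  split => q.
    apply: (@continuous_comp _ _ _ (fun q => (yT q).1) fst); last exact: cvg_fst.
    by apply: (@continuous_comp _ _ _ yT fst); [exact: cF|exact: cvg_fst].
  by apply: (@continuous_comp _ _ _ yT snd); [exact: cF|exact: cvg_snd].
- by split => v; exact: strict_derivative_continuous.
- by split => // v q; exact: strict_derivative_is_derive.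
- move=> k1 k2 q; set q' := q + _.
  have Kq : Kp q' = Kp q by rewrite /Kp /= hKper1 hKper2.
  have st := strictly_C1_extended_field oU ha hOmega hH hatalpha.
  pose y (t : R) := ((x q' t, q.2 + t *: hatalpha), s q' t).
  have soly : is_solution (extended_field a H hatalpha) T y.
    move=> t tT; have Ux := xU q' t tT.
    have q'2 : q'.2 + t *: hatalpha = q.2 + t *: hatalpha + map_mx intr k2.
      by rewrite addrAC.
    apply: is_derive_pair; last first.
      by rewrite /= -(lagrangian_periodic _ k2)// -q'2; exact: hs.
    apply: is_derive_pair; first by rewrite /= -(field_periodic _ k2)// -q'2; exact: dx.
    rewrite -[X in is_derive _ _ _ X]add0r; apply: is_deriveD; exact: is_derive_scale.
  have solq := extended_solution dx hs q.
  have y0 : y 0 = extended_trajectory hatalpha x s q 0.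
    by rewrite /y /extended_trajectory !x0 !s0 Kq.
  have yD (t : R) : 0 <= t <= T -> ((U `*` [set: 'cV[R]_l]) `*` [set: R])
      (extended_trajectory hatalpha x s q t).
    by move=> tT; split => //; split => //; exact: xU.
  have eq := solution_unique st yD solq T0 soly y0 TT.
  by split; [exact: (congr1 (fun z => z.1.1) eq)|exact: (congr1 snd eq)].
- move=> v c q vc.
  exact: (action_identity oU ha hOmega hH T0 hK x0 s0 xU dx hs vc (hdF v q) (hdp v q)).
Qed.

End flow.

(** * Continuity of matrix-valued maps and averages of functions of two angles *)

Lemma continuous_sum (R : realType) (S : topologicalType) (I : Type) (r : seq I)
    (F : I -> S -> R) :
  (forall i, continuous (F i)) -> continuous (fun q => \sum_(i <- r) F i q).
Proof.
move=> cF; elim: r => [|i r IH].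
  by under eq_fun do rewrite big_nil; move=> q; exact: cvg_cst.
under eq_fun do rewrite big_cons.
by move=> q; apply: cvgD; [exact: cF|exact: IH].
Qed.

Lemma continuous_entry (R : realType) (S : topologicalType) (n k : nat)
    (A : S -> 'M[R]_(n, k)) i j : continuous A -> continuous (fun q => A q i j).
Proof.
move=> cA q; apply: (@continuous_comp _ _ _ A (fun M : 'M[R]_(n, k) => M i j)).
  exact: cA.
exact: coord_continuous.
Qed.

Lemma continuous_matrix (R : realType) (S : topologicalType) (n k : nat)
    (A : S -> 'M[R]_(n, k)) : (forall i j, continuous (fun q => A q i j)) -> continuous A.
Proof. by move=> cA q; apply: cvg_mx => i j; exact: cA. Qed.

Lemma continuous_mulmx (R : realType) (S : topologicalType) (n k p : nat)
    (A : S -> 'M[R]_(n, k)) (B : S -> 'M[R]_(k, p)) :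
  continuous A -> continuous B -> continuous (fun q => A q *m B q).
Proof.
move=> cA cB; apply: continuous_matrix => i j.
under eq_fun do rewrite mxE.
apply: continuous_sum => h q.
by apply: cvgM; [exact: continuous_entry|exact: continuous_entry].
Qed.

Lemma continuous_trmx (R : realType) (S : topologicalType) (n k : nat)
    (A : S -> 'M[R]_(n, k)) : continuous A -> continuous (fun q => (A q)^T).
Proof.
move=> cA; apply: continuous_matrix => i j; under eq_fun do rewrite mxE.
exact: continuous_entry.
Qed.

Lemma continuous_dot (R : realType) (S : topologicalType) (N : nat)
    (f g : S -> 'cV[R]_N) : continuous f -> continuous g ->
  continuous (fun q => dot (f q) (g q)).
Proof.
move=> cf cg; apply: continuous_sum => k q.
by apply: cvgM; exact: continuous_entry.
Qed.

Lemma continuousDf (R : realType) (S : topologicalType) (W : normedModType R)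
    (f g : S -> W) : continuous f -> continuous g -> continuous (fun q => f q + g q).
Proof. by move=> cf cg q; apply: cvgD; [exact: cf|exact: cg]. Qed.

Lemma continuousBf (R : realType) (S : topologicalType) (W : normedModType R)
    (f g : S -> W) : continuous f -> continuous g -> continuous (fun q => f q - g q).
Proof. by move=> cf cg q; apply: cvgB; [exact: cf|exact: cg]. Qed.

Lemma continuousNf (R : realType) (S : topologicalType) (W : normedModType R)
    (f : S -> W) : continuous f -> continuous (fun q => - f q).
Proof. by move=> cf q; apply: cvgN; exact: cf. Qed.

Lemma continuous_comp_on (S T W : topologicalType) (D : set T) (f : T -> W) (g : S -> T) :
  (forall z, D z -> {for z, continuous f}) -> continuous g -> (forall q, D (g q)) ->
  continuous (fun q => f (g q)).
Proof.
by move=> cf cg Dg q; apply: (@continuous_comp _ _ _ g f); [exact: cg|exact: cf].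
Qed.

Lemma is_derive_comp_map (R : realType) (V W X : normedModType R) (f : W -> X)
    (g : V -> W) (x v : V) : differentiable g x -> differentiable f (g x) ->
  is_derive x v (fun z => f (g z)) ('D_('D_v g x) f (g x)).
Proof.
move=> dg df; have dfg : differentiable (f \o g) x by exact: differentiable_comp.
apply: DeriveDef; first exact: diff_derivable.
by rewrite deriveE// diff_comp//= [RHS]deriveE// [X in _ = 'd f _ X]deriveE.
Qed.

Lemma dot_mulmxr (R : realType) (n k : nat) (A : 'M[R]_(n, k)) u w :
  dot u (A *m w) = dot (A^T *m u) w.
Proof. by rewrite !dot_mulmx trmx_mul trmxK mulmxA. Qed.

Lemma row_dot (R : realType) (n k : nat) (M : 'M[R]_(n, k)) (u w : 'cV[R]_n) i :
  (forall j, M j i = u j 0) -> (M^T *m w) i 0 = dot u w.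
Proof.
by move=> Mu; rewrite mxE; apply: eq_bigr => j _; rewrite mxE Mu.
Qed.

Section pair_average.
Context (R : realType) (m l : nat).
Notation Q := ('cV[R]_m * 'cV[R]_l)%type.

Definition pair_average (g : Q -> R) : R := average (fun x y => g (x, y)).

Definition lattice_periodic (W : Type) (g : Q -> W) :=
  forall (k1 : 'cV[int]_m) (k2 : 'cV[int]_l) q,
    g (q + (map_mx intr k1, map_mx intr k2)) = g q.

Let jc (g : Q -> R) : continuous g -> jointly_continuous (fun x y => g (x, y)).
Proof.
rewrite /jointly_continuous.
by have -> : (fun q : Q => g (q.1, q.2)) = g by apply/funext => -[].
Qed.

Let per1 (g : Q -> R) y : lattice_periodic g -> Zperiodic (fun x => g (x, y)).
Proof.
move=> pg x k; rewrite -[RHS](pg k 0); congr g; congr (_, _).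
by rewrite /= map_mx0 addr0.
Qed.

Let per2 (g : Q -> R) x : lattice_periodic g -> Zperiodic (fun y => g (x, y)).
Proof.
move=> pg y k; rewrite -[RHS](pg 0 k); congr g; congr (_, _).
by rewrite /= map_mx0 addr0.
Qed.

Lemma pair_averageB g h : continuous g -> continuous h ->
  pair_average (fun q => g q - h q) = pair_average g - pair_average h.
Proof. by move=> cg ch; apply: averageB; exact: jc. Qed.

Lemma pair_averageN g : continuous g ->
  pair_average (fun q => - g q) = - pair_average g.
Proof.
move=> cg; rewrite -[RHS]add0r -(subrr (pair_average g)) -pair_averageB//.
rewrite -pair_averageB//; last exact: continuousBf.
by congr pair_average; apply/funext => q; rewrite subrr sub0r.
Qed.

Lemma pair_average_shift g sh : continuous g -> lattice_periodic g ->
  pair_average (fun q => g (q + sh)) = pair_average g.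
Proof.
move=> cg pg; have := @average_shift R m l (fun x y => g (x, y)) sh.1 sh.2 (jc cg)
  (fun y => per1 y pg) (fun x => per2 x pg).
by case: sh.
Qed.

Lemma pair_average_derive g dg v : continuous g -> continuous dg -> lattice_periodic g ->
  (forall q, is_derive q v g (dg q)) -> pair_average dg = 0.
Proof.
move=> cg cdg pg gdg; apply: (@average_derive R m l (fun x y => g (x, y)) _ v (jc cg) (jc cdg)
  (fun y => per1 y pg) (fun x => per2 x pg)) => -[x y] /=.
by have -> : (fun q : Q => g (q.1, q.2)) = g by apply/funext => -[].
Qed.

End pair_average.

(** * Balance of averages *)

Section balance.
Context (R : realType) (N l m : nat) (U : set 'cV[R]_N) (oU : open U).
Context (a : 'cV[R]_N -> 'cV[R]_N) (ha : Ck 2 U a).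
Context (H : 'cV[R]_N -> 'cV[R]_l -> R).
Context (hH : Ck 2 (U `*` [set: 'cV[R]_l]) (fun p => H p.1 p.2)).
Context (hHper : forall z, U z -> Zperiodic (H z)).
Notation Q := ('cV[R]_m * 'cV[R]_l)%type.
Context (K : Q -> 'cV[R]_N) (hK : Ck 1 setT K) (K_per : lattice_periodic K).
Context (K_U : forall q, U (K q)).
Context (F : Q -> 'cV[R]_N) (F_U : forall q, U (F q)) (F_cont : continuous F).
Context (F_per : lattice_periodic F).
Context (sh : Q).

Definition Kbar q := K (q + sh).
Definition defect q := F q - Kbar q.
Definition dKbar v q := 'D_v K (q + sh).
Definition Jbar q := jac a (Kbar q).
Definition remainder1 q := a (F q) - a (Kbar q).
Definition remainder2 q := a (F q) - a (Kbar q) - Jbar q *m defect q.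

Lemma continuous_K : continuous K.
Proof. by move=> q; apply: differentiable_continuous; case: hK => d _; exact: d. Qed.

Lemma continuous_shift : continuous (fun q : Q => q + sh).
Proof. by apply: continuousDf => q; [exact: cvg_id|exact: cvg_cst]. Qed.

Lemma continuous_Kbar : continuous Kbar.
Proof.
exact: (@continuous_comp_on _ _ _ setT K (fun q : Q => q + sh)
  (fun z _ => @continuous_K z) continuous_shift (fun=> I)).
Qed.

Lemma continuous_dK v : continuous (fun q => 'D_v K q).
Proof. by have [_ cdK] := hK; move=> q; exact: cdK. Qed.

Lemma continuous_dKbar v : continuous (dKbar v).
Proof.
exact: (@continuous_comp_on _ _ _ setT (fun q => 'D_v K q) (fun q : Q => q + sh)
  (fun z _ => @continuous_dK v z) continuous_shift (fun=> I)).
Qed.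

Lemma continuous_defect : continuous defect.
Proof. by apply: continuousBf; [exact: F_cont|exact: continuous_Kbar]. Qed.

Lemma continuous_a_on z : U z -> {for z, continuous a}.
Proof. by move=> Uz; apply: differentiable_continuous; exact: (differentiable_a ha). Qed.

Lemma continuous_a_comp (g : Q -> 'cV[R]_N) : continuous g -> (forall q, U (g q)) ->
  continuous (fun q => a (g q)).
Proof. exact: (continuous_comp_on continuous_a_on). Qed.

Lemma continuous_Jbar : continuous Jbar.
Proof.
apply: continuous_matrix => i j.
have -> : (fun q => Jbar q i j) = (fun q => 'D_(delta_mx j 0) a (Kbar q) i 0).
  by apply/funext => q; rewrite mxE.
apply: (continuous_entry (A := fun q => 'D_(delta_mx j 0) a (Kbar q))).
apply: (@continuous_comp_on _ _ _ U (fun z => 'D_(delta_mx j 0) a z)).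
- move=> z Uz; have [_ da] := ha; have [dda _] := da (delta_mx j 0).
  by apply: differentiable_continuous; exact: dda.
- exact: continuous_Kbar.
- by move=> q; exact: K_U.
Qed.

Lemma continuous_H_comp (g : Q -> 'cV[R]_N) (b : Q -> 'cV[R]_l) :
  continuous g -> continuous b -> (forall q, U (g q)) ->
  continuous (fun q => H (g q) (b q)).
Proof.
move=> cg cb Ug.
apply: (@continuous_comp_on _ _ _ (U `*` [set: 'cV[R]_l]) (fun p => H p.1 p.2)
  (fun q => (g q, b q))).
- by move=> p Dp; apply: differentiable_continuous; exact: (differentiable_H hH).
- by move=> q; exact: (cvg_pair (cg q) (cb q)).
- by move=> q; split => //; exact: Ug.
Qed.

Lemma continuous_remainder1 : continuous remainder1.
Proof.
apply: continuousBf; apply: continuous_a_comp => //; first exact: continuous_Kbar.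
by move=> q; exact: K_U.
Qed.

Lemma continuous_remainder2 : continuous remainder2.
Proof.
apply: continuousBf; first exact: continuous_remainder1.
exact: continuous_mulmx continuous_Jbar continuous_defect.
Qed.

Lemma continuous_Omega_defect : continuous (fun q => Omega a (Kbar q) *m defect q).
Proof.
apply: continuous_mulmx; last exact: continuous_defect.
by apply: continuousBf; [apply: continuous_trmx|]; exact: continuous_Jbar.
Qed.

Lemma Kbar_periodic : lattice_periodic Kbar.
Proof. by move=> k1 k2 q; rewrite /Kbar addrAC K_per. Qed.

Lemma is_derive_Kbar v q : is_derive q v Kbar (dKbar v q).
Proof.
have [df _] : is_derive (q + sh) v K ('D_v K (q + sh)).
  by apply: differentiable_is_derive; case: hK => d _; exact: d.
have E : (fun h : R => h^-1 *: ((K \o shift (q + sh)) (h *: v) - K (q + sh))) =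
    (fun h : R => h^-1 *: ((Kbar \o shift q) (h *: v) - Kbar q)).
  by apply/funext => h /=; rewrite /Kbar addrA.
by split; rewrite /derivable /derive -E.
Qed.

Lemma differentiable_Kbar q : differentiable Kbar q.
Proof.
apply: (@differentiable_comp _ _ _ _ (fun q : Q => q + sh) K).
  by apply: differentiableD; [case: (is_diff_id q)|exact: differentiable_cst].
by case: hK => d _; exact: d.
Qed.

Context (v : Q) (dF : Q -> 'cV[R]_N) (dF_cont : continuous dF).
Context (F_der : forall q, is_derive q v F (dF q)).
Context (p : Q -> R) (p_cont : continuous p) (p_per : lattice_periodic p).
Context (dp : Q -> R) (dp_cont : continuous dp).
Context (p_der : forall q, is_derive q v p (dp q)).
Context (c : R).
Context (action : forall q,
  dot (a (F q)) (dF q) - dp q - c * H (F q) (q.2 + sh.2)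
    = dot (a (K q)) ('D_v K q) - c * H (K q) q.2).

Definition ddefect q := dF q - dKbar v q.

Lemma continuous_ddefect : continuous ddefect.
Proof. by apply: continuousBf => //; exact: continuous_dKbar. Qed.

Lemma is_derive_defect q : is_derive q v defect (ddefect q).
Proof. by apply: is_deriveB; exact: is_derive_Kbar. Qed.

Let w q := dot (a (Kbar q)) (defect q).
Let dw q := dot (Jbar q *m dKbar v q) (defect q) + dot (a (Kbar q)) (ddefect q).
Let psi q := dot (a (K q)) ('D_v K q) - c * H (K q) q.2.

Let continuous_psi : continuous psi.
Proof.
apply: continuousBf.
  apply: continuous_dot; last exact: continuous_dK.
  by apply: continuous_a_comp => //; exact: continuous_K.
move=> q; apply: cvgM; first exact: cvg_cst.
by apply: (continuous_H_comp (g := K) (b := snd)) => //;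
  [exact: continuous_K|move=> q'; exact: cvg_snd].
Qed.

Let psi_periodic : lattice_periodic psi.
Proof.
move=> k1 k2 q; rewrite /psi.
rewrite (@derive_translate _ _ _ K (map_mx intr k1, map_mx intr k2)); last exact: K_per.
by rewrite K_per (hHper (K_U q)).
Qed.

(** The integrand equals (dp - dw) - (psi o shift - psi) by the action identity: an exact
derivative plus a shift difference of periodic functions. *)
Lemma average_balance :
  pair_average (fun q => - dot (dKbar v q) (Omega a (Kbar q) *m defect q)
    + (dot (ddefect q) (remainder1 q) + dot (dKbar v q) (remainder2 q))
    - c * (H (F q) (q.2 + sh.2) - H (Kbar q) (q.2 + sh.2))) = 0.
Proof.
have -> : (fun q => - dot (dKbar v q) (Omega a (Kbar q) *m defect q)
    + (dot (ddefect q) (remainder1 q) + dot (dKbar v q) (remainder2 q))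
    - c * (H (F q) (q.2 + sh.2) - H (Kbar q) (q.2 + sh.2)))
  = (fun q => (dp q - dw q) - (psi (q + sh) - psi q)).
  apply/funext => q; have := action q.
  rewrite /dw /psi /ddefect /remainder2 /remainder1 -/(Kbar q) -/(dKbar v q) /=.
  have dotBl (x y z : 'cV[R]_N) : dot (x - y) z = dot x z - dot y z.
    by rewrite !dot_mulmx raddfB mulmxBl !mxE.
  have dotBr (x y z : 'cV[R]_N) : dot x (y - z) = dot x y - dot x z.
    by rewrite !dot_mulmx mulmxBr !mxE.
  move: (defect q) => e.
  rewrite /Omega -/(Jbar q) mulmxBl !dotBr !dotBl [dot _ ((Jbar q)^T *m _)]dot_mulmxr trmxK.
  rewrite (dotC (a (F q)) (dF q)) (dotC (a (Kbar q)) (dF q)) (dotC (a (Kbar q)) (dKbar v q)).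
  rewrite mulrBr.
  move: (dot (dF q) (a (F q))) (dot (dF q) (a (Kbar q))) (dot (dKbar v q) (Jbar q *m e))
    (dot (Jbar q *m dKbar v q) e) (dot (dKbar v q) (a (F q))) (dot (dKbar v q) (a (Kbar q)))
    (dot (a (K q)) _) (c * H (F q) _) (c * H (Kbar q) _) (c * H (K q) _) (dp q).
  move=> x1 x2 x3 x4 x5 x6 x7 x8 x9 x10 x11; lra.
have cw : continuous w.
  apply: continuous_dot; last exact: continuous_defect.
  by apply: continuous_a_comp; [exact: continuous_Kbar|move=> q; exact: K_U].
have cdw : continuous dw.
  apply: continuousDf; apply: continuous_dot.
  - exact: continuous_mulmx continuous_Jbar (@continuous_dKbar v).
  - exact: continuous_defect.
  - by apply: continuous_a_comp; [exact: continuous_Kbar|move=> q; exact: K_U].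
  - exact: continuous_ddefect.
have w_per : lattice_periodic w.
  by move=> k1 k2 q; rewrite /w /defect Kbar_periodic F_per.
have w_der q : is_derive q v w (dw q).
  apply: is_derive_dot; last exact: is_derive_defect.
  have da : differentiable a (Kbar q) by apply: (differentiable_a ha); exact: K_U.
  have dK' : 'D_v Kbar q = dKbar v q by case: (is_derive_Kbar v q).
  have := is_derive_comp_map v (differentiable_Kbar q) da.
  by rewrite dK' -(jac_differentiable _ da).
have csh : continuous (fun q : Q => psi (q + sh)).
  exact: (@continuous_comp_on _ _ _ setT psi (fun q : Q => q + sh)
    (fun z _ => @continuous_psi z) continuous_shift (fun=> I)).
rewrite pair_averageB; [|exact: continuousBf..].
rewrite pair_averageB// pair_averageB//.
rewrite (pair_average_derive p_cont dp_cont p_per p_der).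
rewrite (pair_average_derive cw cdw w_per w_der).
by rewrite pair_average_shift// !subrr.
Qed.

End balance.

(** * Taylor formula with integral remainder *)

Section taylor.
Context (R : realType) (V : normedModType R) (D : set V).
Context (x v : V) (seg : forall s : R, 0 <= s <= 1 -> D (x + s *: v)).
Notation mu := (@lebesgue_measure R).

Lemma continuous_line : continuous (fun s : R => x + s *: v).
Proof.
move=> s; apply: cvgD; first exact: cvg_cst.
exact: is_derive_continuous (is_derive_scale v s).
Qed.

Lemma taylor_order1 (f f1 : V -> R) :
  (forall z, D z -> is_derive z v f (f1 z)) ->
  (forall z, D z -> {for z, continuous f1}) ->
  f (x + v) - f x = \int[mu]_(s in `[0, 1]) f1 (x + s *: v).
Proof.
move=> df cf1; apply/esym.
have -> : f (x + v) - f x = f (x + 1 *: v) - f (x + 0 *: v).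
  by rewrite scale1r scale0r addr0.
apply: (@FTC_Rintegral R (fun s => f1 (x + s *: v)) (fun s => f (x + s *: v)) 0 1 ltr01).
- move=> s s01; apply: (@continuous_comp _ _ _ (fun s : R => x + s *: v) f1).
    exact: continuous_line.
  by apply: cf1; exact: seg.
- by move=> s s01; apply: is_derive_line; apply: df; exact: seg.
Qed.

Lemma taylor_order2 (f f1 f2 : V -> R) :
  (forall z, D z -> is_derive z v f (f1 z)) ->
  (forall z, D z -> is_derive z v f1 (f2 z)) ->
  (forall z, D z -> {for z, continuous f2}) ->
  f (x + v) - f x - f1 x = \int[mu]_(s in `[0, 1]) ((1 - s) * f2 (x + s *: v)).
Proof.
move=> df df1 cf2.
(* Integration by parts, with the antiderivative written down directly. *)
pose g (s : R) := (1 - s) * f1 (x + s *: v) + f (x + s *: v).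
apply/esym; have -> : f (x + v) - f x - f1 x = g 1 - g 0.
  by rewrite /g subrr mul0r add0r subr0 mul1r scale1r scale0r addr0 opprD addrCA addrC.
apply: (@FTC_Rintegral R (fun s => (1 - s) * f2 (x + s *: v)) g 0 1 ltr01).
- move=> s s01; apply: cvgM.
    by apply: cvgB; [exact: cvg_cst|exact: cvg_id].
  apply: (@continuous_comp _ _ _ (fun s : R => x + s *: v) f2).
    exact: continuous_line.
  by apply: cf2; exact: seg.
- move=> s s01.
  have d1 := is_derive_line (df _ (seg s01)).
  have d2 := is_derive_line (df1 _ (seg s01)).
  have d3 : is_derive s (1 : R) (fun s : R => 1 - s) (-1).
    by rewrite -[X in is_derive _ _ _ X]add0r; apply: is_deriveB.
  have := is_deriveD (is_deriveM d3 d2) d1.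
  rewrite (_ : _ + f1 _ = (1 - s) * f2 (x + s *: v)) //.
  by rewrite /GRing.scale /= mulrN1 addrNK.
Qed.

End taylor.

(** * Averages of the invariance error *)

Theorem lemmaD1 (R : realType) (n d l : nat)
  (hd1 : (1 <= d)%N) (hdn : d = (n - 1)%N)
  (U : set 'cV[R]_(2 * n)) (hU : open U)
  (a : 'cV[R]_(2 * n) -> 'cV[R]_(2 * n)) (ha : Ck 2 U a)
  (hOmega : forall z, U z -> Omega a z \in unitmx)
  (hatalpha : 'cV[R]_l)
  (H : 'cV[R]_(2 * n) -> 'cV[R]_l -> R)
  (hH : Ck 2 (U `*` [set: 'cV[R]_l]) (fun p => H p.1 p.2))
  (hHper : forall z, U z -> Zperiodic (H z))
  (flow : R -> 'cV[R]_(2 * n) -> 'cV[R]_l -> 'cV[R]_(2 * n))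
  (hflow : evolution_operator U a H hatalpha flow)
  (T : R) (hT : 0 < T)
  (omega : 'cV[R]_(d - 1))
  (K : 'cV[R]_(d - 1) -> 'cV[R]_l -> 'cV[R]_(2 * n))
  (hK : Ck 1 [set: 'cV[R]_(d - 1) * 'cV[R]_l] (fun p => K p.1 p.2))
  (hKper1 : forall phi, Zperiodic (K ^~ phi))
  (hKper2 : forall theta, Zperiodic (K theta))
  (hKU : forall theta phi, U (K theta phi))
  (hKT : forall theta phi, maximal_interval U a H hatalpha (K theta phi) phi T) :
  let alpha := T *: hatalpha in
  let F theta phi := flow T (K theta phi) phi in
  let Kbar theta phi := K (theta + omega) (phi + alpha) in
  let E theta phi := F theta phi - Kbar theta phi in
  let DthK theta phi := jac (K ^~ phi) theta in
  let DphK theta phi := jac (K theta) phi in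
  let DthE theta phi := jac (E ^~ phi) theta in
  let DphE theta phi := jac (E theta) phi in
  let XX theta phi := XH a H (K theta phi) phi - DphK theta phi *m hatalpha in
  let eta31 theta phi :=
    - ((DthK (theta + omega) (phi + alpha))^T
         *m Omega a (Kbar theta phi) *m E theta phi) in
  let eta32 theta phi :=
    (- ((XX (theta + omega) (phi + alpha))^T
         *m Omega a (Kbar theta phi) *m E theta phi)) 0 0 in
  let Delta1a theta phi := a (F theta phi) - a (Kbar theta phi) in
  let Delta2a theta phi :=
    a (F theta phi) - a (Kbar theta phi)
      - jac a (Kbar theta phi) *m E theta phi in
  let Delta2H theta phi :=
    H (F theta phi) (phi + alpha) - H (Kbar theta phi) (phi + alpha)
      - (jac_scalar (H ^~ (phi + alpha)) (Kbar theta phi) *m E theta phi) 0 0 in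
  [/\ average_vec eta31
        = - average_vec (fun theta phi =>
              (DthE theta phi)^T *m Delta1a theta phi
            + (DthK (theta + omega) (phi + alpha))^T *m Delta2a theta phi),
      average eta32
        = average (fun theta phi =>
            ((Delta1a theta phi)^T *m (DphE theta phi *m hatalpha)) 0 0)
        + average (fun theta phi =>
            ((Delta2a theta phi)^T
               *m (DphK (theta + omega) (phi + alpha) *m hatalpha)) 0 0)
        - average Delta2H
    &
      forall theta phi,
        (forall s, s \in `[0, 1] -> U (Kbar theta phi + s *: E theta phi)) ->
        [/\ Delta1a theta phi
              = integral01_vec (fun s =>
                  jac a (Kbar theta phi + s *: E theta phi) *m E theta phi),
            Delta2a theta phi
              = integral01_vec (fun s =>
                  (1 - s) *: second_diff a (Kbar theta phi + s *: E theta phi)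
                               (E theta phi) (E theta phi))
          & Delta2H theta phi
              = \int[lebesgue_measure]_(s in `[0, 1])
                  ((1 - s) * second_diff (H ^~ (phi + alpha))
                               (Kbar theta phi + s *: E theta phi)
                               (E theta phi) (E theta phi))]].
Proof.
move=> alpha F Kbar0 E DthK DphK DthE DphE XX eta31 eta32 Delta1a Delta2a Delta2H.
pose sh : 'cV[R]_(d - 1) * 'cV[R]_l := (omega, alpha).
pose Kp (q : 'cV[R]_(d - 1) * 'cV[R]_l) := K q.1 q.2.
have [p [dF [dp [[F_U [F_cont p_cont]] [dF_cont dp_cont] [F_der p_der] per action]]]] :=
  endpoint_calculus hU ha hOmega hH hHper hflow (ltW hT) hK hKper1 hKper2 hKU hKT.
set Fq := fun q : 'cV[R]_(d - 1) * 'cV[R]_l => flow T (K q.1 q.2) q.2 in F_U F_cont F_der per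
    action.
have Kp_C1 : Ck 1 setT Kp := hK.
have Kp_per : lattice_periodic Kp by move=> k1 k2 q; rewrite /Kp /= hKper1 hKper2.
have Kp_U q : U (Kp q) by exact: hKU.
have F_per : lattice_periodic Fq by move=> k1 k2 q; have [] := per k1 k2 q.
have p_per : lattice_periodic p by move=> k1 k2 q; have [] := per k1 k2 q.
have F_der' v q : is_derive q v Fq (dF v q) := strict_derivative_is_derive (F_der v q).
have balance (v : 'cV[R]_(d - 1) * 'cV[R]_l) c : v.2 = c *: hatalpha -> _ = 0 := fun vc =>
  average_balance ha hH hHper hK Kp_per Kp_U F_cont F_per (sh := sh)
    (dF_cont v) (F_der' v) p_cont p_per (dp_cont v) (p_der v) (fun q => action v c q vc).
pose Kb := Kbar Kp sh; pose Er := defect Kp Fq sh.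
pose kb := dKbar Kp sh; pose dE v := ddefect Kp sh v (dF v).
have cKbOE v : continuous (fun q => dot (kb v q) (Omega a (Kb q) *m Er q)).
  apply: continuous_dot; first exact: (continuous_dKbar Kp_C1).
  exact: (continuous_Omega_defect ha Kp_C1 Kp_U F_cont).
have cdE v : continuous (dE v) by exact: (continuous_ddefect Kp_C1).
have cR1 : continuous (remainder1 a Kp Fq sh) by exact: (continuous_remainder1 ha Kp_C1 Kp_U F_U
    F_cont).
have cR2 : continuous (remainder2 a Kp Fq sh) by exact: (continuous_remainder2 ha Kp_C1 Kp_U F_U
    F_cont).
split.
- apply/matrixP => i j; rewrite ord1 /average_vec !mxE {j}.
  (* The i-th entry is the balance for the i-th angle theta, the phase being kept fixed. *)
  pose v : 'cV[R]_(d - 1) * 'cV[R]_l := (delta_mx i 0, 0).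
  pose g1 q := - dot (kb v q) (Omega a (Kb q) *m Er q).
  pose g2 q := dot (dE v q) (remainder1 a Kp Fq sh q) + dot (kb v q) (remainder2 a Kp Fq sh q).
  have kbE theta phi k : DthK (theta + omega) (phi + alpha) k i = kb v (theta, phi) k 0.
    by rewrite /DthK mxE derive_partial_fst.
  have dEE theta phi k : DthE theta phi k i = dE v (theta, phi) k 0.
    have [_ e] := is_derive_partial_fst (is_derive_defect Kp_C1 sh (F_der' v) (theta, phi)).
    rewrite /DthE mxE; exact: (congr1 (fun M : 'cV[R]_(2 * n) => M k 0) e).
  have -> : (fun theta phi => eta31 theta phi i 0) = (fun x y => g1 (x, y)).
    apply/funext => theta; apply/funext => phi.
    rewrite /eta31 mxE -mulmxA (row_dot _ (kbE theta phi)); exact: erefl.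
  have -> : (fun theta phi => ((DthE theta phi)^T *m Delta1a theta phi
            + (DthK (theta + omega) (phi + alpha))^T *m Delta2a theta phi) i 0)
     = (fun x y => g2 (x, y)).
    apply/funext => theta; apply/funext => phi.
    rewrite mxE; congr (_ + _).
      exact: (row_dot (Delta1a theta phi) (dEE theta phi)).
    exact: (row_dot (Delta2a theta phi) (kbE theta phi)).
  rewrite -/(pair_average g1) -/(pair_average g2).
  have cg1 : continuous g1 by apply: continuousNf; exact: cKbOE.
  have cg2 : continuous g2.
    apply: continuousDf; apply: continuous_dot.
    - exact: cdE.
    - exact: cR1.
    - exact: (continuous_dKbar Kp_C1).
    - exact: cR2.
  apply/eqP; rewrite -subr_eq0 -(pair_averageN cg2) -pair_averageB//; last exact: continuousNf.
  apply/eqP; rewrite -[RHS](balance v 0); last by rewrite scale0r.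
  by congr pair_average; apply/funext => q; rewrite mul0r subr0 opprK.
(* The second average is the balance for the phase moving along hatalpha. *)
- pose v : 'cV[R]_(d - 1) * 'cV[R]_l := (0, hatalpha).
  pose DHE q := (jac_scalar (H ^~ (q.2 + alpha)) (Kb q) *m Er q) 0 0.
  pose e32 q := DHE q + dot (kb v q) (Omega a (Kb q) *m Er q).
  pose T1 q := dot (remainder1 a Kp Fq sh q) (dE v q).
  pose T2 q := dot (remainder2 a Kp Fq sh q) (kb v q).
  pose HH q := H (Fq q) (q.2 + alpha) - H (Kb q) (q.2 + alpha).
  have KpE (theta : 'cV[R]_(d - 1)) (phi w : 'cV[R]_l) : is_derive phi w (K theta) ('D_(0, w) Kp
      (theta, phi)).
    have dK : differentiable Kp (theta, phi) by case: hK => dK _; exact: dK.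
    exact: (is_derive_partial_snd (differentiable_is_derive (0, w) dK)).
  have DphKE theta phi : DphK (theta + omega) (phi + alpha) *m hatalpha = kb v (theta, phi).
    apply: (@jac_mulmx _ _ _ _ _ (fun w => 'D_(0, w) Kp (theta + omega, phi + alpha))).
    move=> u w; have dK : differentiable Kp (theta + omega, phi + alpha) by case: hK => dK _;
        exact: dK.
    rewrite !deriveE// -linearD; congr ('d _ _ _); congr (_, _).
    by rewrite /= addr0.
  have DphEE theta phi : DphE theta phi *m hatalpha = dE v (theta, phi).
    apply: (@jac_mulmx _ _ _ _ _ (fun w => dE (0, w) (theta, phi))).
      move=> w; exact: (is_derive_partial_snd (is_derive_defect Kp_C1 sh (F_der' (0, w)) (theta,
          phi))).
    have pairD (u w : 'cV[R]_l) : (0, u + w) = (0, u) + (0, w) :> 'cV[R]_(d - 1) * 'cV[R]_l.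
      by congr (_, _); rewrite /= addr0.
    move=> u w; rewrite /dE /ddefect /dKbar pairD.
    have dK : differentiable Kp ((theta, phi) + sh) by case: hK => dK _; exact: dK.
    have -> : dF ((0, u) + (0, w)) (theta, phi) = dF (0, u) (theta, phi) + dF (0, w) (theta, phi).
      have s1 := strict_derivative_is_derive (strict_derivativeD (F_der (0, u) (theta, phi))
          (F_der (0, w) (theta, phi))).
      by have [_ <-] := F_der' ((0, u) + (0, w)) (theta, phi); have [_ <-] := s1.
    by rewrite !deriveE// linearD opprD addrACA.
  have eta32E : average eta32 = pair_average e32.
    congr average; apply/funext => theta; apply/funext => phi.
    rewrite /eta32 mxE -mulmxA -dot_mulmx.
    have -> : XX (theta + omega) (phi + alpha)
        = hamiltonian_field a H (Kb (theta, phi), phi + alpha) - kb v (theta, phi).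
      by rewrite /XX DphKE (XH_field hOmega).
    have -> : dot (hamiltonian_field a H (Kb (theta, phi), phi + alpha) - kb v (theta, phi))
        (Omega a (Kbar0 theta phi) *m E theta phi)
      = dot (hamiltonian_field a H (Kb (theta, phi), phi + alpha)) (Omega a (Kb (theta, phi)) *m
          Er (theta, phi))
        - dot (kb v (theta, phi)) (Omega a (Kb (theta, phi)) *m Er (theta, phi)).
      by rewrite !dot_mulmx raddfB mulmxBl !mxE.
    (* Skew-symmetry of Omega and the equation of motion turn the X_H part into D_z H E. *)
    rewrite opprB addrC; congr (_ + _).
    rewrite dot_mulmxr.
    have -> : (Omega a (Kb (theta, phi)))^T = - Omega a (Kb (theta, phi)).
      by rewrite /Omega raddfB /= trmxK opprB.
    rewrite mulNmx (field_equation hOmega)//; last exact: Kp_U.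
    by rewrite dot_mulmx raddfN /= trmxK mulNmx mxE opprK.
  have T1E : average (fun theta phi =>
      ((Delta1a theta phi)^T *m (DphE theta phi *m hatalpha)) 0 0) = pair_average T1.
    congr average; apply/funext => theta; apply/funext => phi.
    rewrite DphEE -dot_mulmx; exact: erefl.
  have T2E : average (fun theta phi => ((Delta2a theta phi)^T
      *m (DphK (theta + omega) (phi + alpha) *m hatalpha)) 0 0) = pair_average T2.
    congr average; apply/funext => theta; apply/funext => phi.
    rewrite DphKE -dot_mulmx; exact: erefl.
  suff main : pair_average e32
      = pair_average T1 + pair_average T2 - pair_average (fun q => HH q - DHE q).
    apply: (etrans eta32E); apply: (etrans main).
    by rewrite -T1E -T2E.
  have cb : continuous (fun q : 'cV[R]_(d - 1) * 'cV[R]_l => q.2 + alpha).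
    by apply: continuousDf => q; [exact: cvg_snd|exact: cvg_cst].
  have cDHE : continuous DHE.
    apply: continuous_entry; apply: continuous_mulmx; last exact: (continuous_defect Kp_C1).
    apply: continuous_matrix => i j.
    have -> : (fun q => jac_scalar (H ^~ (q.2 + alpha)) (Kb q) i j)
      = (fun q => 'D_(delta_mx j 0, 0) (fun p => H p.1 p.2) (Kb q, q.2 + alpha)).
      by apply/funext => q; rewrite mxE derive_partial_fst.
    apply: (@continuous_comp_on _ _ _ (U `*` [set: 'cV[R]_l])
      (fun p => 'D_(delta_mx j 0, 0) (fun p => H p.1 p.2) p) (fun q => (Kb q, q.2 + alpha))).
    - move=> z Dz; have [_ dH] := hH; have [ddH _] := dH (delta_mx j 0, 0).
      by apply: differentiable_continuous; exact: ddH.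
    - by move=> q; exact: (cvg_pair (@continuous_Kbar _ _ _ _ _ Kp_C1 sh q) (cb q)).
    - by move=> q; split => //; exact: Kp_U.
  have cHH : continuous HH.
    apply: continuousBf; apply: (continuous_H_comp hH).
    - exact: F_cont.
    - exact: cb.
    - exact: F_U.
    - exact: (continuous_Kbar Kp_C1).
    - exact: cb.
    - by move=> q; exact: Kp_U.
  have ce32 : continuous e32 := continuousDf cDHE (cKbOE v).
  have cT1 : continuous T1 := continuous_dot cR1 (cdE v).
  have cT2 : continuous T2 := continuous_dot cR2 (@continuous_dKbar _ _ _ _ _ Kp_C1 sh v).
  have cD2 : continuous (fun q => HH q - DHE q) := continuousBf cHH cDHE.
  suff : pair_average (fun q => (e32 q - T1 q) - (T2 q - (HH q - DHE q))) = 0.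
    rewrite pair_averageB; [|exact: continuousBf..].
    rewrite (pair_averageB ce32 cT1) (pair_averageB cT2 cD2).
    by move=> /eqP; rewrite -addrA -opprD subr_eq0 addrA => /eqP.
  have b0 := balance v 1 (esym (scale1r _)).
  rewrite -[RHS]oppr0 -b0 -pair_averageN.
    congr pair_average; apply/funext => q.
    rewrite /e32 /T1 /T2 /HH mul1r -/(kb v q) -/(dE v q) -/(Kb q) -/(Er q).
    rewrite (dotC (remainder1 _ _ _ _ _)) (dotC (remainder2 _ _ _ _ _)) /=.
    move: (DHE q) (dot (kb v q) _) (dot (dE v q) _) (dot (kb v q) _) (H (Fq q) _) (H (Kb q) _).
    move=> x1 x2 x3 x4 x5 x6; ring.
  apply: continuousBf.
    apply: continuousDf; first by apply: continuousNf; exact: cKbOE.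
    apply: continuousDf; apply: continuous_dot.
    - exact: cdE.
    - exact: cR1.
    - exact: (continuous_dKbar Kp_C1).
    - exact: cR2.
  by move=> q; apply: cvgM; [exact: cvg_cst|exact: cHH].
- move=> theta phi seg0.
  have seg (s : R) : 0 <= s <= 1 -> U (Kbar0 theta phi + s *: E theta phi).
    by move=> s01; apply: seg0; rewrite in_itv.
  have FE : F theta phi = Kbar0 theta phi + E theta phi by rewrite /E addrC subrK.
  have [da dda] := ha; have [dda1 dda2] := dda (E theta phi).
  have ader z k : U z -> is_derive z (E theta phi) (fun z => a z k 0)
      ('D_(E theta phi) a z k 0).
    by move=> Uz; apply: is_derive_entry; apply: differentiable_is_derive; exact: da.
  have jacE z : U z -> jac a z *m E theta phi = 'D_(E theta phi) a z.
    by move=> Uz; apply: jac_differentiable; exact: da.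
  have Kb_U : U (Kbar0 theta phi) by exact: hKU.
  split.
  + apply/matrixP => k j; rewrite ord1 {j} /Delta1a /integral01_vec !mxE FE.
    have cont z : U z -> {for z, continuous (fun z => 'D_(E theta phi) a z k 0)}.
      move=> Uz; apply: (@continuous_comp _ _ _ (fun z => 'D_(E theta phi) a z)
        (fun M : 'cV[R]_(2 * n) => M k 0)); last exact: coord_continuous.
      by apply: differentiable_continuous; exact: dda1.
    apply: (etrans (taylor_order1 seg (f := fun z => a z k 0) (fun z => @ader z k) cont)).
    apply: eq_Rintegral => s; rewrite inE/= in_itv/= => s01.
    by rewrite jacE//; exact: seg.
  + apply/matrixP => k j; rewrite ord1 {j} /Delta2a jacE// /integral01_vec !mxE FE.
    have ader2 z : U z -> is_derive z (E theta phi) (fun z => 'D_(E theta phi) a z k 0)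
        (second_diff a z (E theta phi) (E theta phi) k 0).
      by move=> Uz; apply: is_derive_entry; apply: differentiable_is_derive; exact: dda1.
    have cont z : U z ->
        {for z, continuous (fun z => second_diff a z (E theta phi) (E theta phi) k 0)}.
      move=> Uz; apply: (@continuous_comp _ _ _
        (fun z => second_diff a z (E theta phi) (E theta phi))
        (fun M : 'cV[R]_(2 * n) => M k 0)); last exact: coord_continuous.
      by apply: dda2.
    apply: (etrans (taylor_order2 seg (f := fun z => a z k 0) (fun z => @ader z k) ader2 cont)).
    by apply: eq_Rintegral => s _; rewrite mxE.
  + set b := phi + alpha; set e := E theta phi in FE seg *.
    have [_ dH] := hH; have [dH1 dH2] := dH (e, 0).
    have Hder z : U z -> is_derive z e (H ^~ b) ('D_(e, 0) (fun p => H p.1 p.2) (z, b)).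
      move=> Uz; rewrite -derive_partial_fst; apply: differentiable_is_derive.
      exact: (differentiable_H_partial hH).
    have Hder2 z : U z -> is_derive z e (fun z => 'D_(e, 0) (fun p => H p.1 p.2) (z, b))
        ('D_(e, 0) (fun p => 'D_(e, 0) (fun p => H p.1 p.2) p) (z, b)).
      move=> Uz; apply: (@is_derive_partial_fst _ _ _ _ (fun p => 'D_(e, 0) (fun p => H p.1 p.2)
          p)).
      by apply: differentiable_is_derive; exact: dH1.
    rewrite /Delta2H -/b -/e jac_scalar_mulmx; last exact: (differentiable_H_partial hH).
    rewrite derive_partial_fst FE.
    have cont z : U z ->
        {for z, continuous (fun z => 'D_(e, 0) (fun p => 'D_(e, 0) (fun p => H p.1 p.2) p) (z, b))}.
      move=> Uz; apply: (@continuous_comp _ _ _ (fun z => (z, b))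
        (fun p => 'D_(e, 0) (fun p => 'D_(e, 0) (fun p => H p.1 p.2) p) p)).
        apply: differentiable_continuous.
        by apply: differentiable_pair; [case: (is_diff_id z)|exact: differentiable_cst].
      by apply: dH2.
    have sec z : U z -> second_diff (H ^~ b) z e e
        = 'D_(e, 0) (fun p => 'D_(e, 0) (fun p => H p.1 p.2) p) (z, b).
      move=> Uz; have [_ <-] := Hder2 z Uz; rewrite /second_diff; congr ('D_e _ z).
      by apply/funext => y; exact: derive_partial_fst.
    apply: (etrans (taylor_order2 seg (f := H ^~ b) Hder Hder2 cont)).
    apply: eq_Rintegral => s; rewrite inE => s01.
    have s01' : 0 <= s <= 1 by move: s01; rewrite /= in_itv.
    exact: (congr1 (fun r : R => (1 - s) * r) (esym (sec _ (seg s s01')))).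
Qed.
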